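(* For each integer $d\ge 2$ let $\lambda=\lambda(d)>0$, and suppose that $\liminf_{d\to\infty}\frac{\lambda\kappa_d}{d}>2$ and that the limit $x:=\lim_{d\to\infty}\frac1d\log(\lambda\kappa_d)$ exists in $[0,\infty]$. Let $h^{(d)}_\lambda:=h^{(d)}_\lambda(u)$ denote the support function of the Poisson polytope $K^d_\lambda$ in a direction $u\in\mathbb S^{d-1}$ (its law does not depend on $u$). Then the random variable $$d\left(\log\frac{1}{\sqrt{1-\bigl(h^{(d)}_\lambda\bigr)^2}}-\frac{1}{d+1}\log(\lambda\kappa_d)\right)+\log\sqrt{\mathfrak m(d)}$$ converges in distribution, as $d\to\infty$, to the standard Gumbel distribution, where $$\mathfrak m(d):=\begin{cases}4\pi\log(\lambda\kappa_d),&\text{if } x=0 \text{ (subcritical regime, } \log(\lambda\kappa_d)\ll d),\\ 2\pi d\,(1-e^{-2x}),&\text{if } x\in(0,\infty)\text{ (critical regime, } \log(\lambda\kappa_d)\sim dx),\\ 2\pi d\left(1-(\lambda\kappa_d)^{-\frac{2}{d+1}}\right),&\text{if } x=\infty\text{ (supercritical regime, } \log(\lambda\kappa_d)\gg d).\end{cases}$$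
   Context: $\mathbb B^d$ is the closed Euclidean unit ball of $\mathbb R^d$, $\mathbb S^{d-1}$ the unit sphere, and $\kappa_d=\pi^{d/2}/\Gamma(1+\frac d2)$ is the volume of $\mathbb B^d$. For each $d\ge2$, $\mathcal P^d_\lambda$ is a homogeneous Poisson point process on $\mathbb R^d$ with intensity $\lambda=\lambda(d)>0$, and $K^d_\lambda$ is the convex hull of $\mathcal P^d_\lambda\cap\mathbb B^d$. The support function is $h^{(d)}_\lambda(u):=\sup\{\langle u,x\rangle:x\in K^d_\lambda\}$ for $u\in\mathbb S^{d-1}$, with value $-\infty$ if $K^d_\lambda$ is empty; under the hypothesis on $\liminf\lambda\kappa_d/d$, $h^{(d)}_\lambda\in[0,1]$ with probability tending to $1$, so the displayed variable is well defined with probability tending to $1$ (its value on the exceptional event is irrelevant). The standard Gumbel distribution has c.d.f. $\tau\mapsto e^{-e^{-\tau}}$, $\tau\in\mathbb R$. *)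

(* Defs.v *)
From HB Require Import structures.
From mathcomp Require Import all_boot all_order all_algebra.
From mathcomp Require Import all_classical all_reals all_analysis.
From mathcomp Require Import measurable_realfun.

Set Implicit Arguments.
Unset Strict Implicit.
Unset Printing Implicit Defensive.

Import Order.TTheory GRing.Theory Num.Theory.
Import numFieldNormedType.Exports.

Local Open Scope classical_set_scope.
Local Open Scope ring_scope.

(* The library norm on 'rV[R]_d is the sup norm, hence the Euclidean structure
   below; both induce the same topology. *)
Definition dotprod (R : realType) (d : nat) (x y : 'rV[R]_d) : R :=
  \sum_(i < d) x 0 i * y 0 i.

Definition enorm (R : realType) (d : nat) (x : 'rV[R]_d) : R :=
  Num.sqrt (dotprod x x).

Definition unit_ball (R : realType) (d : nat) : set 'rV[R]_d :=
  [set x | enorm x <= 1].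

Definition unit_sphere (R : realType) (d : nat) : set 'rV[R]_d :=
  [set x | enorm x = 1].

Definition borel (R : realType) (d : nat) : set_system 'rV[R]_d :=
  <<s [set A : set 'rV[R]_d | open A] >>.

(* d-dimensional Lebesgue measure as an iterated product: the step is the
   unfolding of the library's product measure (A is mapped to the integral of
   the measures of its sections) through the identification of R^(1+d) with
   R x R^d given by row_mx; 'rV_0 is a point of mass 1. Only its values on
   Borel sets matter. *)
Fixpoint volume (R : realType) (d : nat) : set 'rV[R]_d -> \bar R :=
  match d return set 'rV[R]_d -> \bar R with
  | 0%N => fun A => (\1_A (0 : 'rV[R]_0))%:E
  | d'.+1 => fun A =>
      (\int[@lebesgue_measure R]_t
         volume [set v : 'rV[R]_d' |
                  A (row_mx (\row_(_ < 1) t) v : 'rV[R]_(1 + d'))])%E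
  end.

Definition Gamma (R : realType) (s : R) : R :=
  \int[@lebesgue_measure R]_(t in `]0, +oo[) (t `^ (s - 1) * expR (- t)).

Definition kappa (R : realType) (d : nat) : R :=
  pi `^ (d%:R / 2) / Gamma (1 + d%:R / 2).

(* A homogeneous Poisson process has almost surely no multiple points, so it is
   given as a random set of points X. The first argument of poisson_prob is the
   mean (mean 0 giving the Dirac mass at 0); its second one is unused. *)
Record poisson_process (disp : measure_display) (T : measurableType disp)
    (R : realType) (P : probability T R) (d : nat) (lambda : R)
    (X : T -> set 'rV[R]_d) : Prop := PoissonProcess {
  poisson_process_measurable : forall A : set 'rV[R]_d, borel A ->
    measurable_fun [set: T] (fun w => @counting _ R (X w `&` A)) ;
  poisson_process_law : forall A : set 'rV[R]_d, borel A ->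
    (volume A < +oo)%E -> forall k : nat,
    P [set w | counting (X w `&` A) = k%:R%:E :> \bar R] =
      poisson_prob (lambda * fine (volume A)) 0%N [set k] ;
  poisson_process_independent :
    forall (n : nat) (A : 'I_n -> set 'rV[R]_d) (U : 'I_n -> set (\bar R)),
    (forall i, borel (A i)) -> trivIset [set: 'I_n] A ->
    (forall i, measurable (U i)) ->
    P [set w | forall i, U i (counting (X w `&` A i))] =
      (\prod_(i < n) P [set w | U i (counting (X w `&` A i))])%E
}.

Definition convex_hull (R : realType) (d : nat) (A : set 'rV[R]_d) :
    set 'rV[R]_d :=
  smallest (fun C => convex_set (C : set (convex_lmodType 'rV[R]_d))) A.

Definition poisson_polytope (T : Type) (R : realType) (d : nat)
    (X : T -> set 'rV[R]_d) (w : T) : set 'rV[R]_d :=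
  convex_hull (X w `&` @unit_ball R d).

Definition support_fun (R : realType) (d : nat) (K : set 'rV[R]_d)
    (u : 'rV[R]_d) : \bar R :=
  ereal_sup [set (dotprod u x)%:E | x in K].

(* lk stands for lambda * kappa_d; the case x = -oo never occurs. *)
Definition regime_const (R : realType) (x : \bar R) (lk : R) (d : nat) : R :=
  match x with
  | r%:E => if r == 0 then 4 * pi * ln lk
            else 2 * pi * d%:R * (1 - expR (- (2 * r)))
  | +oo%E => 2 * pi * d%:R * (1 - lk `^ (- (2 / (d%:R + 1))))
  | -oo%E => 0
  end.

(* Off the event 0 <= h < 1 (in particular when h = -oo, where fine h = 0)
   the value is an irrelevant convention. *)
Definition rescaled_support (R : realType) (x : \bar R) (lk : R) (d : nat)
    (h : \bar R) : R :=
  d%:R * (ln (1 / Num.sqrt (1 - fine h ^+ 2)) - 1 / (d%:R + 1) * ln lk)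
  + ln (Num.sqrt (regime_const x lk d)).

(* The random variables Y n may live on different probability spaces. Being a
   statement about n -> oo, only almost all of them need be measurable. *)
Definition cvg_in_distribution (R : realType) (disp : nat -> measure_display)
    (T : forall n, measurableType (disp n)) (P : forall n, probability (T n) R)
    (Y : forall n, T n -> R) (F : R -> R) : Prop :=
  (\forall n \near \oo, measurable_fun [set: T n] (Y n)) /\
  forall t : R, {for t, continuous F} ->
    (fun n => P n [set w | Y n w <= t]) @ \oo --> (F t)%:E.

Definition gumbel_cdf (R : realType) (t : R) : R := expR (- expR (- t)).

(* Main.v *)
(* The support function satisfies h <= s iff no Poisson point lies in the cap
   {x in B^d : <u, x> > s}, so P(h <= s) = exp (- lambda V(s)) with
   V(s) = kappa_(d-1) * int_s^1 (1 - y^2)^((d-1)/2) dy. Taking s^2 = 1 - e^(-2b)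
   with b = log(lambda kappa_d)/(d+1) + (t - log(m)/2)/d, the event of the
   theorem is h <= s up to events of vanishing probability, and
   (1 - s^2)^((d+1)/2) = e^(-(d+1)b) cancels lambda kappa_d up to a factor
   tending to e^(-t) sqrt m. An integration by parts shows
   V(s) ~ kappa_(d-1) (1 - s^2)^((d+1)/2) / (s (d+1)) as soon as d s^2 -> oo,
   and kappa_(d-1) / kappa_d ~ sqrt (d / (2 pi)) by Wallis' integrals; hence
   lambda V(s) -> e^(-t) provided m ~ 2 pi d s^2, which is what the three
   definitions of m(d) achieve.
   The only invariance of Lebesgue measure needed is that of the plane under
   rotations. *)
Require Import Defs.
From HB Require Import structures.
From mathcomp Require Import all_boot all_order all_algebra.
From mathcomp Require Import all_classical all_reals all_analysis.
From mathcomp Require Import measurable_realfun.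
From mathcomp Require Import ring lra.

Set Implicit Arguments.
Unset Strict Implicit.
Unset Printing Implicit Defensive.

Import Order.TTheory GRing.Theory Num.Theory.
Import numFieldNormedType.Exports.

Local Open Scope classical_set_scope.
Local Open Scope ring_scope.

(** * Rotation invariance of planar Lebesgue measure *)

(** Two obstacles shape the proof. [volume] is computed coordinate by coordinate, while a cap points
    in an arbitrary direction; so coordinates are split off one at a time, and each time only the
    plane of that coordinate and of the remaining part of the direction is rotated. And [kappa] is
    given by a Gamma integral, so it must be tied to volumes of slices: both sides obey two-step
    recurrences, started from Gamma(1) and Gamma(3/2). The centring divides log(lambda kappa_d) by d
    + 1, but t and log m by d. Hence e^(-(d+1) b) cancels lambda kappa_d exactly and leaves e^(-t
    (d+1)/d) sqrt m e^(log m / (2 d)): besides m ~ 2 pi d s^2, the proof needs log m = o(d). The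
    exceptional events are h <= 0, of probability e^(-lambda kappa_d / 2) by the symmetry of the
    ball, and h >= 1, which is null. The liminf hypothesis is used as lambda kappa_d > 2 d for large
    d, which makes log(lambda kappa_d) tend to infinity and the former probability tend to 0. *)

(** The pushforward under [a * x + b], scaled by [a], gives half-open intervals their length, which
    characterises Lebesgue measure. *)
Lemma lebesgue_measure_affine (R : realType) (a b : R) (A : set R) :
  0 < a -> measurable A ->
  (lebesgue_measure A =
   a%:E * lebesgue_measure ((fun x => (a * x + b)%R) @^-1` A))%E.
Proof.
move=> a0 mA.
have mphi : measurable_fun setT (fun x : measurableTypeR R =>
    a * x + b : measurableTypeR R).
  by apply: measurable_funD => //; exact: mulrl_measurable.
pose phi := fun x : measurableTypeR R => a * x + b : measurableTypeR R.
pose m := mscale (NngNum (ltW a0)) (pushforward lebesgue_measure phi).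
rewrite (lebesgue_measure_unique (mu := m mphi)) // => _ [[c d]] _ <- /=.
rewrite /m /mscale /= /pushforward.
have -> : phi @^-1` [set` `]c, d]] =
   [set` `](c - b) / a, (d - b) / a]].
  apply/seteqP; split => x /=;
  by rewrite /phi !in_itv/= ltr_pdivrMr // ler_pdivlMr // ltrBlDr lerBrDr [x * a]mulrC.
rewrite !lebesgue_measure_itv/= !lte_fin ltr_pM2r ?invr_gt0// ltrD2r.
case: ifP => _; last by rewrite mule0.
rewrite -!EFinB -EFinM; congr EFin; field; exact: lt0r_neq0.
Qed.

Lemma ge0_integral_affine (R : realType) (a b : R) (f : R -> \bar R) :
  0 < a -> measurable_fun setT f -> (forall x, 0 <= f x)%E ->
  (\int[lebesgue_measure]_x f x =
   a%:E * \int[lebesgue_measure]_x f (a * x + b)%R)%E.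
Proof.
move=> a0 mf f0.
have mphi : measurable_fun setT (fun x : measurableTypeR R =>
    a * x + b : measurableTypeR R).
  by apply: measurable_funD => //; exact: mulrl_measurable.
pose phi := fun x : measurableTypeR R => a * x + b : measurableTypeR R.
pose m := mscale (NngNum (ltW a0)) (pushforward lebesgue_measure phi).
rewrite (@eq_measure_integral _ _ _ _ (m mphi)); last first.
  by move=> A mA _; exact: lebesgue_measure_affine.
rewrite /m ge0_integral_mscale //; congr (_ * _)%E.
by rewrite ge0_integral_pushforward.
Qed.

Lemma ge0_integral_shift (R : realType) (b : R) (f : R -> \bar R) :
  measurable_fun setT f -> (forall x, 0 <= f x)%E ->
  (\int[lebesgue_measure]_x f (x + b)%R = \int[lebesgue_measure]_x f x)%E.
Proof.
move=> mf f0; rewrite [RHS](ge0_integral_affine b ltr01 mf f0) mul1e.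
by under [RHS]eq_integral do rewrite mul1r.
Qed.

Lemma ge0_integral_opp (R : realType) (f : R -> \bar R) :
  measurable_fun setT f -> (forall x, 0 <= f x)%E ->
  (\int[lebesgue_measure]_x f (- x)%R = \int[lebesgue_measure]_x f x)%E.
Proof.
move=> mf f0.
transitivity (\int[pushforward lebesgue_measure
    (-%R : _ -> measurableTypeR R)]_x f x)%E.
  rewrite ge0_integral_pushforward//.
by apply: eq_measure_integral => A mA _; exact: lebesgue_measureN.
Qed.

(** Tonelli makes the sheared coordinate the inner variable, where for fixed y the shear is a
    translation. *)
Lemma ge0_integral_shear (R : realType) (a : R) (f : R * R -> \bar R) :
  measurable_fun setT f -> (forall z, 0 <= f z)%E ->
  (\int[lebesgue_measure]_x \int[lebesgue_measure]_y f (x + a * y, y)%R =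
   \int[lebesgue_measure]_x \int[lebesgue_measure]_y f (x, y))%E.
Proof.
move=> mf f0.
have mg : measurable_fun setT (fun z : measurableTypeR R * measurableTypeR R =>
    f (z.1 + a * z.2, z.2)).
  apply: (measurableT_comp mf); apply: measurable_fun_pair => //=.
  apply: measurable_funD => //; apply: measurable_funM => //.
transitivity (\int[lebesgue_measure]_y \int[lebesgue_measure]_x
    f (x + a * y, y)%R)%E.
  by apply: (@fubini_tonelli _ _ (measurableTypeR R) (measurableTypeR R) R
    lebesgue_measure lebesgue_measure _ mg) => z; exact: f0.
transitivity (\int[lebesgue_measure]_y \int[lebesgue_measure]_x f (x, y))%E;
  last first.
  by apply/esym; exact: (@fubini_tonelli _ _ (measurableTypeR R)
    (measurableTypeR R) R lebesgue_measure lebesgue_measure f).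
apply: eq_integral => y _.
apply: (@ge0_integral_shift R _ (fun x => f (x, y))) => //.
by apply: measurableT_comp mf _; exact: measurable_fun_pair.
Qed.

Lemma ge0_integral_swap_shear (R : realType) (a : R) (f : R * R -> \bar R) :
  measurable_fun setT f -> (forall z, 0 <= f z)%E ->
  (\int[lebesgue_measure]_x \int[lebesgue_measure]_y f (x, y + a * x)%R =
   \int[lebesgue_measure]_x \int[lebesgue_measure]_y f (x, y))%E.
Proof.
move=> mf f0; apply: eq_integral => x _.
apply: (@ge0_integral_shift R _ (fun y => f (x, y))) => //.
by apply: measurableT_comp mf _; exact: measurable_fun_pair.
Qed.

(* A rotation is a product of three shears as soon as its sine is nonzero. *)
Lemma ge0_integral_rotation (R : realType) (c s : R) (f : R * R -> \bar R) :
  c ^+ 2 + s ^+ 2 = 1 -> s != 0 ->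
  measurable_fun setT f -> (forall z, 0 <= f z)%E ->
  (\int[lebesgue_measure]_x \int[lebesgue_measure]_y
     f (c * x + s * y, c * y - s * x)%R =
   \int[lebesgue_measure]_x \int[lebesgue_measure]_y f (x, y))%E.
Proof.
(* For c = cos v and s = sin v this is tan(v/2); the shears have coefficients [a], [- s], [a]. *)
move=> cs s0 mf f0; pose a := (1 - c) / s.
have mS1 (g : R * R -> \bar R) : measurable_fun setT g ->
    measurable_fun setT (fun z : R * R => g (z.1 + a * z.2, z.2)).
  move=> mg; apply: (measurableT_comp mg); apply: measurable_fun_pair => //=.
  by apply: measurable_funD => //; apply: measurable_funM.
have mS2 (g : R * R -> \bar R) : measurable_fun setT g ->
    measurable_fun setT (fun z : R * R => g (z.1, z.2 + (- s) * z.1)).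
  move=> mg; apply: (measurableT_comp mg); apply: measurable_fun_pair => //=.
  by apply: measurable_funD => //; apply: measurable_funM.
etransitivity; last exact: (ge0_integral_shear a mf f0).
etransitivity; last exact: (ge0_integral_swap_shear (- s) (mS1 _ mf)).
etransitivity; last exact: (ge0_integral_shear a (mS2 _ (mS1 _ mf))).
apply: eq_integral => x _; apply: eq_integral => y _ /=; congr (f (_, _)).
  rewrite /a mulNr.
  transitivity (c * x + (1 - c ^+ 2) / s * y).
    by congr (_ + _ * _); rewrite -cs addrAC subrr add0r expr2 mulfK.
  by field.
by rewrite /a; field.
Qed.

(** * Wallis integrals *)

Lemma is_derive_FTC2 (R : realType) (F f : R -> R) (a b : R) : a < b ->
  (forall x : R, is_derive x 1 F (f x)) -> continuous f ->
  \int[lebesgue_measure]_(x in `[a, b]) f x = F b - F a.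
Proof.
move=> ab dF cf; rewrite /Rintegral (@continuous_FTC2 _ f F) //.
- exact: continuous_subspaceT.
- have cF : continuous F.
    by move=> x; apply: differentiable_continuous; apply/derivable1_diffP.
  by split=> //; [apply: cvg_at_right_filter|apply: cvg_at_left_filter]; exact: cF.
- by move=> x _; rewrite derive1E derive_val.
Qed.

Lemma continuous_integrable_itv (R : realType) (f : R -> R) (a b : R) :
  continuous f -> lebesgue_measure.-integrable `[a, b] (EFin \o f).
Proof.
move=> cf; apply: continuous_compact_integrable; first exact: segment_compact.
exact: continuous_subspaceT.
Qed.

(** Twice the classical Wallis integral: t runs over the whole range needed for the substitution y =
    r sin t on [-r, r]. *)
Definition wallis (R : realType) (m : nat) : R :=
  \int[lebesgue_measure]_(x in `[- (pi / 2), pi / 2]) cos x ^+ m.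

Lemma ltNpi2_pi2 (R : realType) : - (pi / 2) < pi / 2 :> R.
Proof. by rewrite gtrN // divr_gt0 // pi_gt0. Qed.

Lemma continuous_cosX (R : realType) (m : nat) : continuous (fun x : R => cos x ^+ m).
Proof.
move=> x; apply: (@continuous_comp R R R cos (fun y => y ^+ m)).
  exact: continuous_cos.
exact: exprn_continuous.
Qed.

Lemma wallis0 (R : realType) : wallis R 0 = pi.
Proof.
rewrite /wallis (@is_derive_FTC2 _ id) ?ltNpi2_pi2 //.
- by field.
- exact: cst_continuous.
Qed.

Lemma wallis1 (R : realType) : wallis R 1 = 2.
Proof.
rewrite /wallis (@is_derive_FTC2 _ sin) ?ltNpi2_pi2 //.
- by rewrite sinN sin_pihalf opprK.
- exact: continuous_cosX.
Qed.

(** The difference of the two sides is the integral of the derivative of sin cos^(m+1), which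
    vanishes at both ends. *)
Lemma wallisS (R : realType) (m : nat) :
  m.+2%:R * wallis R m.+2 = m.+1%:R * wallis R m.
Proof.
have cm k : continuous (fun x : R => k%:R * cos x ^+ m).
  by move=> x; apply: cvgM; [exact: cvg_cst|exact: continuous_cosX].
have cm2 k : continuous (fun x : R => k%:R * cos x ^+ m.+2).
  by move=> x; apply: cvgM; [exact: cvg_cst|exact: continuous_cosX].
apply/eqP; rewrite -subr_eq0; apply/eqP; rewrite /wallis.
rewrite -!RintegralZl//; try by apply: continuous_integrable_itv; exact: continuous_cosX.
rewrite -RintegralB//; try by exact: continuous_integrable_itv.
have dF (x : R) : is_derive x 1 (sin * cos ^+ m.+1 : R -> R)
    (m.+2%:R * cos x ^+ m.+2 - m.+1%:R * cos x ^+ m).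
  apply: is_derive_eq.
  rewrite !fctE /GRing.scale /= !exprS.
  have -> : cos x * (cos x * cos x ^+ m) = (1 - sin x ^+ 2) * cos x ^+ m.
    by rewrite mulrA -expr2 cos2sin2.
  have -> : cos x * cos x ^+ m * cos x = (1 - sin x ^+ 2) * cos x ^+ m.
    by rewrite -cos2sin2; ring.
  rewrite -[m.+2%:R]natr1; ring.
rewrite (is_derive_FTC2 _ dF) ?ltNpi2_pi2 //.
  by rewrite !fctE cosN cos_pihalf !expr0n /= !mulr0 subrr.
by move=> x; apply: cvgB; [exact: cm2|exact: cm].
Qed.

Lemma wallis_gt0 (R : realType) (m : nat) : 0 < wallis R m.
Proof.
suff : (0 < wallis R m) && (0 < wallis R m.+1) by case/andP.
elim: m => [|m /andP[m0 m1]]; first by rewrite wallis0 wallis1 pi_gt0 ltr0n.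
rewrite m1 /= -(pmulr_rgt0 _ (ltr0Sn R m.+1)) wallisS.
by rewrite mulr_gt0 // ltr0Sn.
Qed.

(** The recurrence makes this product independent of m. With monotonicity it confines W_m^2 between
    2 pi / (m+1) and 2 pi / m, so no Stirling formula is needed. *)
Lemma wallisM (R : realType) (m : nat) :
  m.+1%:R * (wallis R m.+1 * wallis R m) = 2 * pi.
Proof.
elim: m => [|m IH]; first by rewrite wallis0 wallis1 mul1r.
by rewrite mulrA wallisS -mulrA (mulrC (wallis R m)).
Qed.

Lemma wallis_decreasing (R : realType) (m : nat) : wallis R m.+1 <= wallis R m.
Proof.
apply: le_Rintegral => //.
- by apply: continuous_integrable_itv; exact: continuous_cosX.
- by apply: continuous_integrable_itv; exact: continuous_cosX.
- move=> x /=; rewrite in_itv /= => /cos_ge0_pihalf c0.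
  by rewrite exprS ler_piMl ?exprn_ge0 // cos_le1.
Qed.

(* z^(k/2) for z >= 0, with 0^0 = 1, and 0 for z < 0: kappa R k * hpow k (q - y^2)
   is the volume of the section at height y of the ball of squared radius q. *)
Definition hpow (R : realType) (k : nat) (z : R) : R :=
  if 0 <= z then Num.sqrt z ^+ k else 0.

Lemma hpow_ge0 (R : realType) (k : nat) (z : R) : 0 <= hpow k z.
Proof. by rewrite /hpow; case: ifP => // _; rewrite exprn_ge0 // sqrtr_ge0. Qed.

Lemma measurable_hpow (R : realType) (k : nat) :
  measurable_fun setT (@hpow R k).
Proof.
apply: measurable_fun_if => //.
- by apply: measurable_fun_ler => //; exact: measurable_cst.
- apply: measurable_funTS; apply: measurable_funX.
  by apply: continuous_measurable_fun; exact: sqrt_continuous.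
Qed.

Lemma sqrt_subr_sqr_le (R : realType) (z y : R) : 0 <= z ->
  (0 <= z - y ^+ 2) = (- Num.sqrt z <= y <= Num.sqrt z).
Proof.
move=> z0; rewrite subr_ge0 -ler_norml -{1}(sqr_sqrtr z0) -[y ^+ 2]real_normK ?num_real //.
by rewrite ler_pXn2r // nnegrE ?sqrtr_ge0.
Qed.

(** For r = sqrt z, the substitution y = r sin t turns sqrt(z - y^2) into r cos t, and dy
    contributes one more factor r cos t. *)
Lemma integral_hpow (R : realType) (k : nat) (z : R) :
  (\int[lebesgue_measure]_y (hpow k (z - y ^+ 2))%:E =
   (wallis R k.+1 * hpow k.+1 z)%:E)%E.
Proof.
have [z0|z0] := ltP z 0.
  rewrite /hpow leNgt z0 /= mulr0 integral0_eq // => y _.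
  by rewrite ifN // -ltNge subr_lt0 (lt_le_trans z0) // sqr_ge0.
rewrite [hpow _ z]/hpow z0; set r : R := Num.sqrt z.
transitivity (\int[lebesgue_measure]_(y in `[(- r)%R, r]) (Num.sqrt (z - y ^+ 2) ^+ k)%:E)%E.
  rewrite [RHS]integral_mkcond; apply: eq_integral => y _.
  rewrite patchE /hpow sqrt_subr_sqr_le //.
  rewrite mem_setE in_itv /=; case: ifP => //.
have cG : continuous (fun y : R => Num.sqrt (z - y ^+ 2) ^+ k).
  move=> y; apply: (@continuous_comp R R R (fun y => Num.sqrt (z - y ^+ 2)) (fun y => y ^+ k)).
    apply: (@continuous_comp R R R (fun y => z - y ^+ 2) Num.sqrt).
      by apply: cvgB; [exact: cvg_cst|exact: exprn_continuous].
    exact: sqrt_continuous.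
  exact: exprn_continuous.
(* For r = 0 the substitution is constant, but the domain is a single point and the right-hand side
   has a positive power of 0. *)
have [r0|r0] := eqVneq r 0.
  by rewrite r0 oppr0 set_itv1 integral_set1 expr0n mulr0.
have {}r0 : 0 < r by rewrite lt_neqAle eq_sym r0 sqrtr_ge0.
pose F : R -> R := r \*: sin.
have dF (t : R) : is_derive t 1 F (r * cos t).
  by rewrite /F; apply: is_derive_eq.
have F'E : derive1 F = (fun t => r * cos t).
  by apply/funext => t; rewrite derive1E derive_val.
have cF' : continuous (derive1 F).
  by rewrite F'E => t; apply: cvgM; [exact: cvg_cst|exact: continuous_cos].
have cF : continuous F.
  by move=> t; apply: differentiable_continuous; apply/derivable1_diffP.
have FN : F (- (pi / 2)) = - r by rewrite /F /= sinN sin_pihalf /GRing.scale /= mulrN1.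
have FP : F (pi / 2) = r by rewrite /F /= sin_pihalf /GRing.scale /= mulr1.
rewrite -{1}FN -{1}FP integration_by_substitution_increasing //.
- transitivity (\int[lebesgue_measure]_(t in `[(- (pi / 2))%R, (pi / 2)%R])
      (r ^+ k.+1 * cos t ^+ k.+1)%:E)%E.
    apply: eq_integral => t; rewrite inE /= in_itv /= => /cos_ge0_pihalf c0.
    rewrite !fctE F'E /F /= /GRing.scale /=; congr EFin.
    have -> : z - (r * sin t) ^+ 2 = (r * cos t) ^+ 2.
      by rewrite !exprMn sqr_sqrtr // cos2sin2; ring.
    by rewrite sqrtr_sqr ger0_norm ?(mulr_ge0 (ltW r0)) // -exprSr exprMn.
  rewrite (mulrC (wallis R k.+1)) /wallis -RintegralZl //; last first.
    by apply: continuous_integrable_itv; exact: continuous_cosX.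
  rewrite /Rintegral fineK //; apply: integrable_fin_num => //.
  apply: (@continuous_integrable_itv _ (fun t => r ^+ k.+1 * cos t ^+ k.+1)) => t.
  by apply: cvgM; [exact: cvg_cst|exact: continuous_cosX].
- by rewrite ltW // ltNpi2_pi2.
- move=> x y xi yi xy; rewrite /F /= /GRing.scale /= ltr_pM2l //.
  by rewrite ltr_sin.
- by apply: cvgP; apply: cvg_at_right_filter; exact: cF'.
- by apply: cvgP; apply: cvg_at_left_filter; exact: cF'.
- by split => //; [apply: cvg_at_right_filter|apply: cvg_at_left_filter]; exact: cF.
- exact: continuous_subspaceT.
Qed.

(** * The Gamma function at half-integers and the constants kappa *)

(** For t >= 1, sqrt t <= t, and e^t is at least its Taylor term of degree k + 1; the quotient is
    (k+1)! / t. *)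
Lemma cvgr_sqrt_exp_expRN (R : realType) (k : nat) :
  Num.sqrt t ^+ k * expR (- t) @[t --> +oo] --> (0 : R).
Proof.
apply: (@squeeze_cvgr _ _ _ _ (cst 0) (fun t : R => k.+1`!%:R / t)).
- near=> t; rewrite /= mulr_ge0 ?exprn_ge0 ?sqrtr_ge0 ?expR_ge0 //=.
  have t1 : 1 <= t by near: t; exact: nbhs_pinfty_ge.
  have t0 : 0 < t by exact: lt_le_trans t1.
  have st : Num.sqrt t <= t.
    by rewrite -[leRHS]sqr_sqrtr ?(ltW t0) // ler_eXnr // -sqrtr1 ler_sqrt.
  have f0 : 0 < k.+1`!%:R :> R by rewrite ltr0n fact_gt0.
  rewrite expRN ler_pdivlMr // mulrAC ler_pdivrMr ?expR_gt0 // -ler_pdivrMl //.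
  apply: (@le_trans _ _ (t ^+ k.+1 / k.+1`!%:R)); last first.
    by apply: le_trans (expR_ge1Dxn k (ltW t0)); rewrite lerDr.
  rewrite mulrC ler_pM2r ?invr_gt0 //.
  by rewrite exprSr ler_wpM2r ?(ltW t0) // lerXn2r // nnegrE ?sqrtr_ge0 // ltW.
- exact: cvg_cst.
- rewrite -(mulr0 k.+1`!%:R); apply: cvgM; first exact: cvg_cst.
  apply/gtr0_cvgV0; last exact: cvg_id.
  by near=> t; near: t; exact: nbhs_pinfty_gt.
Unshelve. all: end_near. Qed.

(* Working with primitives of t^(k/2) e^(-t) lets the recurrence in k be checked
   by differentiation, with a single passage to integrals at the end. *)
Definition half_gamma_primitive (R : realType) (k : nat) (F : R -> R) (l : R) :=
  [/\ (forall t : R, 0 < t -> is_derive t 1 F (Num.sqrt t ^+ k * expR (- t))),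
      F 0 = 0, F t @[t --> 0^'+] --> F 0 & F t @[t --> +oo] --> l].

Lemma continuous_sqrt_exp_expRN (R : realType) (k : nat) :
  continuous (fun t : R => Num.sqrt t ^+ k * expR (- t)).
Proof.
move=> t; apply: cvgM.
  apply: (@continuous_comp R R R Num.sqrt (fun y => y ^+ k)).
    exact: sqrt_continuous.
  exact: exprn_continuous.
apply: (@continuous_comp R R R -%R expR); last exact: continuous_expR.
exact: opp_continuous.
Qed.

Lemma half_gamma_primitive_Gamma (R : realType) (k : nat) (F : R -> R) (l : R) :
  half_gamma_primitive k F l -> Gamma (1 + k%:R / 2) = l.
Proof.
move=> [dF F0 F0r Fy]; rewrite /Gamma.
pose f (t : R) := Num.sqrt t ^+ k * expR (- t).
transitivity (\int[lebesgue_measure]_(t in `]0, +oo[) f t).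
  apply: eq_Rintegral => t; rewrite inE /= in_itv /= andbT => t0; rewrite /f.
  by rewrite addrC addKr -powR_mulrn ?sqrtr_ge0 //
    -powR12_sqrt ?(ltW t0) // -powRrM [2^-1 * _]mulrC.
have -> : \int[lebesgue_measure]_(t in `]0, +oo[) f t =
    \int[lebesgue_measure]_(t in `[0, +oo[) f t.
  rewrite /Rintegral integral_itv_obnd_cbnd //; apply/measurable_EFinP.
  apply: measurable_funTS; apply: continuous_measurable_fun.
  exact: continuous_sqrt_exp_expRN.
rewrite (@Rintegral_ge0_continuous_FTC2y _ f F 0 l) ?F0 ?subr0 //.
- by move=> t _; rewrite mulr_ge0 ?exprn_ge0 ?sqrtr_ge0 ?expR_ge0.
- by apply: continuous_subspaceT; exact: continuous_sqrt_exp_expRN.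
- by move=> t t0; have := dF t t0 => -[].
- by rewrite -[X in _ --> X]F0.
- move=> t; rewrite in_itv /= andbT => t0; rewrite derive1E.
  by have := dF t t0 => ?; rewrite derive_val.
Qed.

Lemma half_gamma_primitive0 (R : realType) :
  half_gamma_primitive 0 (fun t : R => 1 - expR (- t)) 1.
Proof.
have cF : continuous (fun t : R => 1 - expR (- t)).
  move=> t; apply: cvgB; first exact: cvg_cst.
  apply: (@continuous_comp R R R -%R expR); last exact: continuous_expR.
  exact: opp_continuous.
split.
- move=> t _; rewrite expr0 mul1r.
  have -> : (fun t : R => 1 - expR (- t)) = cst 1 - (expR \o -%R) by [].
  by apply: is_derive_eq; rewrite mulrN1 sub0r opprK.
- by rewrite oppr0 expR0 subrr.
- by apply: cvg_at_right_filter; exact: cF.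
- rewrite -[X in _ --> X](subr0 1); apply: cvgB; first exact: cvg_cst.
  exact: cvgr_expR.
Qed.

(** This is Gamma(s + 1) = s Gamma(s) at s = 1 + k/2, before passing to integrals: the subtracted
    product is the boundary term of the integration by parts, and it vanishes at 0 and at
    infinity. *)
Lemma half_gamma_primitiveSS (R : realType) (k : nat) (F : R -> R) (l : R) :
  half_gamma_primitive k F l ->
  half_gamma_primitive k.+2
    (fun t => k.+2%:R / 2 * F t - Num.sqrt t ^+ k.+2 * expR (- t))
    (k.+2%:R / 2 * l).
Proof.
move=> [dF F0 F0r Fy]; split.
- move=> t t0; have dFt := dF t t0.
  have st0 := is_derive1_sqrt t0.
  have dE : is_derive t 1 (fun t : R => expR (- t)) (- expR (- t)).
    have -> : (fun t : R => expR (- t)) = expR \o -%R by [].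
    by apply: is_derive_eq; rewrite mulrN1.
  have dS : is_derive t 1 (fun t : R => Num.sqrt t ^+ k.+2)
      (k.+2%:R / 2 * Num.sqrt t ^+ k).
    have -> : (fun t : R => Num.sqrt t ^+ k.+2) = Num.sqrt ^+ k.+2.
      by apply/funext => z; rewrite exprfctE.
    apply: (is_derive_eq (is_deriveX k.+2 st0)); rewrite /GRing.scale /= exprS.
    have s0 : Num.sqrt t != 0 by rewrite gt_eqF // sqrtr_gt0.
    by field.
  apply: (is_derive_eq (is_deriveB (is_deriveZ (k.+2%:R / 2) dFt) (is_deriveM dS dE))).
  by rewrite /GRing.scale /=; ring.
- by rewrite F0 sqrtr0 expr0n mulr0 mul0r subr0.
- apply: cvgB; first by apply: cvgM; [exact: cvg_cst|].
  by apply: cvg_at_right_filter; exact: continuous_sqrt_exp_expRN.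
- rewrite -[X in _ --> X](subr0 (k.+2%:R / 2 * l)); apply: cvgB.
    by apply: cvgM; [exact: cvg_cst|].
  exact: cvgr_sqrt_exp_expRN.
Qed.

Lemma cvgr_sqrt_pinfty (R : realType) : Num.sqrt t @[t --> +oo] --> (+oo : set_system R).
Proof.
apply/cvgryPge => A; near=> t.
have At : A ^+ 2 <= t by near: t; apply: nbhs_pinfty_ge; exact: num_real.
by rewrite (le_trans (ler_norm A)) // -sqrtr_sqr ler_sqrt // (le_trans _ At) ?sqr_ge0.
Unshelve. all: end_near. Qed.

(** Substituting t = v^2 and integrating v (2 v e^(-v^2)) by parts leaves the Gaussian integral up
    to sqrt t. *)
Lemma half_gamma_primitive1 (R : realType) :
  half_gamma_primitive 1
    (fun t : R => gauss_integral_proof.integral0_gauss (Num.sqrt t)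
       - Num.sqrt t * expR (- t))
    (Num.sqrt pi / 2).
Proof.
have E0 : gauss_integral_proof.integral0_gauss 0 = 0 :> R.
  by rewrite /gauss_integral_proof.integral0_gauss set_itv1 Rintegral_set1.
have Ix (x : R) : lebesgue_measure.-integrable `[0, x] (EFin \o @gauss_fun R).
  by apply: continuous_integrable_itv; exact: continuous_gauss_fun.
have Ele (x : R) : 0 <= x -> gauss_integral_proof.integral0_gauss x <= x.
  move=> x0; rewrite /gauss_integral_proof.integral0_gauss.
  apply: (@le_trans _ _ (\int[lebesgue_measure]_(t in `[0, x]) (1 : R))).
    apply: le_Rintegral => //.
    - by apply: continuous_integrable_itv; exact: cst_continuous.
    - by move=> t _; exact: gauss_fun_le1.
  rewrite Rintegral_cst //= lebesgue_measure_itv /= lte_fin mul1r.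
  by case: ifP => // _; rewrite oppr0 addr0.
split.
- move=> t t0; have st0 := is_derive1_sqrt t0.
  have s0 : 0 < Num.sqrt t by rewrite sqrtr_gt0.
  have dG : is_derive (Num.sqrt t) 1 (@gauss_integral_proof.integral0_gauss R) (expR (- t)).
    have [||||d e] := @continuous_FTC1 R (@gauss_fun R) (BLeft 0)
      (Num.sqrt t) (Num.sqrt t + 1).
    - by rewrite ltrDl.
    - exact: Ix.
    - by rewrite /= lte_fin.
    - exact: continuous_gauss_fun.
    - by apply: DeriveDef => //; rewrite -derive1E e /gauss_fun sqr_sqrtr // ltW.
  have dGs : is_derive t 1 (fun t => gauss_integral_proof.integral0_gauss (Num.sqrt t))
      (expR (- t) * (2 * Num.sqrt t)^-1).
    exact: (is_derive1_comp dG st0).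
  have dE : is_derive t 1 (fun t : R => expR (- t)) (- expR (- t)).
    have -> : (fun t : R => expR (- t)) = expR \o -%R by [].
    by apply: is_derive_eq; rewrite mulrN1.
  apply: (is_derive_eq (is_deriveB dGs (is_deriveM st0 dE))).
  by rewrite /GRing.scale /= expr1; ring.
- by rewrite sqrtr0 E0 mul0r subr0.
- rewrite sqrtr0 E0 mul0r subr0 -[X in _ --> X](subr0 0); apply: cvgB.
    apply: (@squeeze_cvgr _ _ _ _ (cst 0) Num.sqrt).
    - by near=> t; rewrite gauss_integral_proof.integral0_gauss_ge0 Ele ?sqrtr_ge0.
    - exact: cvg_cst.
    - rewrite -[X in _ --> X]sqrtr0; apply: cvg_at_right_filter; exact: sqrt_continuous.
  have := @continuous_sqrt_exp_expRN R 1 0.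
  rewrite /continuous_at sqrtr0 expr1 mul0r => h.
  by apply: cvg_at_right_filter.
- rewrite -[X in _ --> X](subr0 (Num.sqrt pi / 2)); apply: cvgB; last first.
    exact: (@cvgr_sqrt_exp_expRN R 1).
  apply: (cvg_comp Num.sqrt _ (@cvgr_sqrt_pinfty R)).
  (* The Gaussian integral is known through the limit pi / 4 of its square; being nonnegative, it is
     recovered by a square root. *)
  have : Num.sqrt (@gauss_integral_proof.integral0_gauss R x ^+ 2) @[x --> +oo]
      --> Num.sqrt (pi / 4).
    apply: continuous_cvg; first exact: sqrt_continuous.
    exact: gauss_integral_proof.cvg_integral0_gauss_sqr.
  under eq_fun do rewrite sqrtr_sqr ger0_norm ?gauss_integral_proof.integral0_gauss_ge0 //.
  suff -> : Num.sqrt (pi / 4) = Num.sqrt pi / 2 :> R by [].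
  rewrite sqrtrM ?pi_ge0 // sqrtrV //; congr (_ / _).
  by rewrite (_ : 4 = 2 ^+ 2) ?sqrtr_sqr ?ger0_norm // -natrX.
Unshelve. all: end_near. Qed.

(** The recurrence moves by two, so the induction carries k and k + 1, starting from Gamma(1) = 1
    and Gamma(3/2) = sqrt pi / 2. The existence of a primitive is what propagates; the recurrence
    and the positivity are read off from it. *)
Lemma Gamma_half (R : realType) (k : nat) :
  [/\ exists F, half_gamma_primitive k F (Gamma (1 + k%:R / 2 : R)),
     Gamma (1 + k.+2%:R / 2 : R) = k.+2%:R / 2 * Gamma (1 + k%:R / 2) &
     0 < Gamma (1 + k%:R / 2 : R)].
Proof.
have step j (l : R) : 0 < l -> (exists F, half_gamma_primitive j F l) ->
    [/\ exists F, half_gamma_primitive j F (Gamma (1 + j%:R / 2 : R)),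
      Gamma (1 + j.+2%:R / 2 : R) = j.+2%:R / 2 * Gamma (1 + j%:R / 2) &
      0 < Gamma (1 + j%:R / 2 : R)].
  move=> l0 [F hF]; rewrite (half_gamma_primitive_Gamma hF).
  by rewrite (half_gamma_primitive_Gamma (half_gamma_primitiveSS hF)); split => //; exists F.
suff: forall j, (j = k \/ j = k.+1) ->
    [/\ exists F, half_gamma_primitive j F (Gamma (1 + j%:R / 2 : R)),
      Gamma (1 + j.+2%:R / 2 : R) = j.+2%:R / 2 * Gamma (1 + j%:R / 2) &
      0 < Gamma (1 + j%:R / 2 : R)] by apply; left.
elim: k => [|k IH] j.
- case=> ->; first by apply: (step _ 1) => //; by eexists; exact: (half_gamma_primitive0 R).
  apply: (step _ (Num.sqrt pi / 2)); last first.
    by eexists; exact: (half_gamma_primitive1 R).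
  by rewrite divr_gt0 // sqrtr_gt0 pi_gt0.
- case=> ->; first by apply: IH; right.
  have [[F hF] e p] := IH k (or_introl erefl).
  apply: (step _ (k.+2%:R / 2 * Gamma (1 + k%:R / 2))).
    by rewrite mulr_gt0 // divr_gt0.
  eexists; exact: (half_gamma_primitiveSS hF).
Qed.

Lemma kappa_gt0 (R : realType) (d : nat) : 0 < kappa R d.
Proof. by have [_ _ G0] := Gamma_half R d; rewrite divr_gt0 ?powR_gt0 ?pi_gt0. Qed.

Lemma kappa0 (R : realType) : kappa R 0 = 1.
Proof.
have := half_gamma_primitive_Gamma (half_gamma_primitive0 R).
by rewrite /kappa => ->; rewrite mul0r powRr0 divr1.
Qed.

Lemma kappa1 (R : realType) : kappa R 1 = 2.
Proof.
have := half_gamma_primitive_Gamma (half_gamma_primitive1 R).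
rewrite /kappa => ->; rewrite div1r powR12_sqrt ?pi_ge0 //.
have : Num.sqrt pi != 0 :> R by rewrite gt_eqF // sqrtr_gt0 pi_gt0.
by move=> ?; field.
Qed.

Lemma kappaSS (R : realType) (d : nat) :
  d.+2%:R * kappa R d.+2 = 2 * pi * kappa R d.
Proof.
have [_ e G0] := Gamma_half R d; rewrite /kappa e.
have -> : d.+2%:R / 2 = d%:R / 2 + 1 :> R by rewrite -addn2 natrD; field.
rewrite powRD ?powRr1 ?pi_ge0 //; last by rewrite (gt_eqF (pi_gt0 _)) implybT.
have -> : d%:R / 2 + 1 = d.+2%:R / 2 :> R by rewrite -addn2 natrD; field.
have G1 : Gamma (1 + d%:R / 2) != 0 :> R by rewrite gt_eqF.
have d0 : d.+2%:R != 0 :> R by rewrite pnatr_eq0.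
by field; rewrite G1 -natrD.
Qed.

(** Both sides satisfy the same two-step recurrence, by [kappaSS] on the left and by [wallisS]
    together with [kappaSS] on the right. This is where the Gamma formula meets the slicing of
    balls. *)
Lemma kappaS (R : realType) (d : nat) : kappa R d.+1 = wallis R d.+1 * kappa R d.
Proof.
elim/ltn_ind: d => -[_|[_|d IH]].
- by rewrite kappa0 kappa1 wallis1 mulr1.
- have := kappaSS R 0; have := wallisS R 0.
  rewrite kappa0 kappa1 wallis0 !mulr1 mul1r => w k.
  apply: (@mulfI _ 2); first by rewrite pnatr_eq0.
  by rewrite k mulrA w mulrC.
- have h1 := kappaSS R d.+1; have h2 := kappaSS R d; have h3 := wallisS R d.+1.
  have h4 := IH d (leqW (leqnn _)).
  apply: (@mulfI _ d.+3%:R); first by rewrite pnatr_eq0.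
  apply: (@mulfI _ d.+2%:R); first by rewrite pnatr_eq0.
  rewrite h1 h4 (mulrA d.+3%:R) h3.
  rewrite [RHS](_ : _ = d.+2%:R * wallis R d.+1 * (d.+2%:R * kappa R d.+2)); last by ring.
  by rewrite h2; ring.
Qed.

(** * Volume of spherical caps *)

Lemma kappa_ge0 (R : realType) (d : nat) : 0 <= kappa R d.
Proof. exact: ltW (kappa_gt0 R d). Qed.

Lemma integral_kappa_hpow (R : realType) (d : nat) (z : R) :
  (\int[lebesgue_measure]_y (kappa R d * hpow d (z - y ^+ 2))%:E =
   (kappa R d.+1 * hpow d.+1 z)%:E)%E.
Proof.
under eq_integral do rewrite EFinM.
rewrite ge0_integralZl_EFin //.
- by rewrite integral_hpow -EFinM kappaS mulrA (mulrC (kappa R d)).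
- by move=> y _; rewrite lee_fin hpow_ge0.
- apply/measurable_EFinP; apply: (measurableT_comp (@measurable_hpow R d)).
  by apply: measurable_funB => //; exact: exprn_measurable.
- exact: kappa_ge0.
Qed.

(** The reflection t -> -t serves where no rotation is available: in dimension one, and for a
    direction along the first axis. *)
Lemma integral_slices_opp (R : realType) (k : nat) (C s q a : R) : 0 <= C ->
  (\int[lebesgue_measure]_t
     (C * hpow k (q - t ^+ 2) * (s < a * t)%R%:R)%:E =
   \int[lebesgue_measure]_t
     (C * hpow k (q - t ^+ 2) * (s < `|a| * t)%R%:R)%:E)%E.
Proof.
move=> C0; have [a0|a0] := leP 0 a; first by rewrite ger0_norm.
rewrite ltr0_norm // -[RHS]ge0_integral_opp.
- by under [RHS]eq_integral do rewrite sqrrN mulrN -mulNr opprK.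
- apply/measurable_EFinP; apply: measurable_funM.
    apply: measurable_funM => //; apply: (measurableT_comp (@measurable_hpow R k)).
    by apply: measurable_funB => //; exact: exprn_measurable.
  apply: (measurableT_comp (f := fun b : bool => b%:R : R)) => //.
  by apply: measurable_fun_ltr => //; apply: measurable_funM.
- by move=> t; rewrite lee_fin !mulr_ge0 ?hpow_ge0.
Qed.

(** The weight depends on (t, y) only through t^2 + y^2, so the plane may be rotated with cosine a/N
    and sine b/N, which turns a t + b y into N t. The constraint then no longer involves y, and y is
    integrated out. *)
Lemma integral_slices_rotation (R : realType) (k : nat) (s q a b : R) : 0 <= b ->
  (\int[lebesgue_measure]_t \int[lebesgue_measure]_y
     (kappa R k * hpow k (q - t ^+ 2 - y ^+ 2) * (s - a * t < b * y)%R%:R)%:E =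
   \int[lebesgue_measure]_t
     (kappa R k.+1 * hpow k.+1 (q - t ^+ 2)
        * (s < Num.sqrt (a ^+ 2 + b ^+ 2) * t)%R%:R)%:E)%E.
Proof.
move=> b0; set N : R := Num.sqrt _.
have inner (e : R) (t : R) : 0 <= e ->
   (\int[lebesgue_measure]_y
     (kappa R k * hpow k (q - t ^+ 2 - y ^+ 2) * e)%:E =
   (kappa R k.+1 * hpow k.+1 (q - t ^+ 2) * e)%:E)%E.
  move=> e0; under eq_integral do rewrite EFinM.
  rewrite ge0_integralZr //.
  - by rewrite integral_kappa_hpow EFinM.
  - apply/measurable_EFinP; apply: measurable_funM => //.
    apply: (measurableT_comp (@measurable_hpow R k)).
    by apply: measurable_funB => //; exact: exprn_measurable.
  - by move=> y _; rewrite lee_fin mulr_ge0 ?hpow_ge0 ?kappa_ge0 ?ler0n.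
(* For b = 0 the sine vanishes, and N = |a| may be 0 as well, so this case only uses the
   reflection. *)
move: b0; rewrite le_eqVlt => /predU1P[b0|b0].
  rewrite /N -b0 expr0n /= addr0 sqrtr_sqr. rewrite -integral_slices_opp ?kappa_ge0 //.
  apply: eq_integral => t _; under eq_integral do rewrite mul0r subr_lt0.
  by rewrite inner.
have N0 : 0 < N by rewrite sqrtr_gt0 ltr_wpDl ?sqr_ge0 // exprn_gt0.
have N2 : N ^+ 2 = a ^+ 2 + b ^+ 2 by rewrite sqr_sqrtr // addr_ge0 ?sqr_ge0.
pose f (z : R * R) :=
  ((kappa R k * hpow k (q - z.1 ^+ 2 - z.2 ^+ 2) * (s < N * z.1)%R%:R)%:E).
have f0 z : (0 <= f z)%E.
  by rewrite lee_fin mulr_ge0 ?ler0n // mulr_ge0 ?hpow_ge0 ?kappa_ge0.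
have mf : measurable_fun setT f.
  apply/measurable_EFinP; apply: measurable_funM.
    apply: measurable_funM => //; apply: (measurableT_comp (@measurable_hpow R k)).
    apply: measurable_funB; last exact: measurable_funX.
    by apply: measurable_funB => //; exact: measurable_funX.
  apply: (measurableT_comp (f := fun b : bool => b%:R : R)) => //.
  by apply: measurable_fun_ltr => //; apply: measurable_funM.
transitivity (\int[lebesgue_measure]_t \int[lebesgue_measure]_y
   f (a / N * t + b / N * y, a / N * y - b / N * t)%R)%E.
  apply: eq_integral => t _; apply: eq_integral => y _; rewrite /f /=.
  congr (_ * hpow k _ * _)%:E.
    have -> : q - t ^+ 2 - y ^+ 2 = q - (a ^+ 2 + b ^+ 2) / N ^+ 2 * (t ^+ 2 + y ^+ 2).
      by rewrite -N2 divff ?gt_eqF ?exprn_gt0 // mul1r opprD addrA.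
    by field; rewrite gt_eqF.
  have -> : N * (a / N * t + b / N * y) = a * t + b * y by field; rewrite gt_eqF.
  by rewrite ltrBlDl.
rewrite (ge0_integral_rotation _ _ mf f0).
- by apply: eq_integral => t _; rewrite /f /= inner ?ler0n.
- by rewrite !expr_div_n -mulrDl -N2 divff // gt_eqF // exprn_gt0.
- by rewrite mulf_neq0 ?invr_neq0 ?gt_eqF.
Qed.

Lemma dotprod_row_mx (R : realType) (d : nat) (a b : 'rV[R]_1) (u v : 'rV[R]_d) :
  dotprod (row_mx a u : 'rV_d.+1) (row_mx b v : 'rV_d.+1) =
  a 0 0 * b 0 0 + dotprod u v.
Proof.
rewrite /dotprod; etransitivity; first exact: (@big_split_ord _ _ _ 1 d).
rewrite /= big_ord1 !(@row_mxEl _ 1 1 d); congr (_ + _).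
by apply: eq_bigr => i _; rewrite !(@row_mxEr _ 1 1 d).
Qed.

Lemma dotprod_ge0 (R : realType) (d : nat) (u : 'rV[R]_d) : 0 <= dotprod u u.
Proof. by apply: sumr_ge0 => i _; rewrite -expr2 sqr_ge0. Qed.

(* Split off the first coordinate t. By induction the section is an integral over
   y along the direction of the remaining coordinates of u, and a rotation of the
   (t, y)-plane makes the constraint depend on t alone. *)
Lemma volume_cap (R : realType) (d : nat) (u : 'rV[R]_d.+1) (s q : R) :
  volume [set x | dotprod x x <= q /\ s < dotprod u x] =
  (\int[lebesgue_measure]_y
    (kappa R d * hpow d (q - y ^+ 2) * (s < enorm u * y)%R%:R)%:E)%E.
Proof.
elim: d u s q => [|d IH] u s q.
  rewrite /enorm /dotprod big_ord1 -expr2 sqrtr_sqr -integral_slices_opp ?kappa_ge0 //.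
  (* In 'rV_0 the inner volume is an indicator, and so is [hpow 0], thanks to 0^0 = 1. *)
  apply: eq_integral => t _; rewrite kappa0 mul1r /hpow expr0 subr_ge0.
  rewrite indicE; congr EFin.
  have E (v : 'rV[R]_0) : (row_mx (\row_(_ < 1) t) v : 'rV_1) 0 ord0 = t.
    have -> : ord0 = lshift 0 ord0 :> 'I_(1 + 0) by exact: val_inj.
    by rewrite (@row_mxEl _ 1 1 0) mxE.
  rewrite (_ : (_ \in _) = (t ^+ 2 <= q) && (s < u 0 ord0 * t)); last first.
    by apply/idP/idP; rewrite in_setE /= !big_ord1 !E -expr2 => /andP.
  by case: (t ^+ 2 <= q); rewrite ?mul1r ?mul0r.
rewrite -(hsubmxK (u : 'rV_(1 + d.+1))); set a := lsubmx _; set u' := rsubmx _.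
rewrite /enorm dotprod_row_mx -[dotprod u' u']sqr_sqrtr ?dotprod_ge0 // -expr2.
rewrite -integral_slices_rotation ?sqrtr_ge0 //.
(* The section at t is a cap of squared radius [q - t ^+ 2] and level [s - a * t] in the direction
   u', which need not be a unit vector: hence the generality in [u], [s] and [q]. *)
apply: eq_integral => t _; rewrite -/(enorm u') -IH.
apply: (f_equal (@volume R d.+1)); apply/seteqP.
split => v /=; rewrite !dotprod_row_mx !mxE -expr2.
- by rewrite lerBrDl ltrBlDl.
- by rewrite lerBrDl ltrBlDl.
Qed.

Definition cap_integral (R : realType) (d : nat) (s : R) : R :=
  \int[lebesgue_measure]_(y in `[s, 1]) Num.sqrt (1 - y ^+ 2) ^+ d.

Lemma continuous_sqrt_onem_sqr (R : realType) (d : nat) :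
  continuous (fun y : R => Num.sqrt (1 - y ^+ 2) ^+ d).
Proof.
move=> y; apply: (@continuous_comp R R R (fun y => Num.sqrt (1 - y ^+ 2)) (fun y => y ^+ d)).
  apply: (@continuous_comp R R R (fun y => 1 - y ^+ 2) Num.sqrt).
    by apply: cvgB; [exact: cvg_cst|exact: exprn_continuous].
  exact: sqrt_continuous.
exact: exprn_continuous.
Qed.

Lemma volume_unit_cap (R : realType) (d : nat) (u : 'rV[R]_d.+1) (s : R) :
  enorm u = 1 -> -1 <= s ->
  volume [set x | dotprod x x <= 1 /\ s < dotprod u x] =
  (kappa R d * cap_integral d s)%:E.
Proof.
move=> u1 s1; rewrite volume_cap u1.
transitivity (\int[lebesgue_measure]_(y in `]s, 1%R])
    (kappa R d * Num.sqrt (1 - y ^+ 2) ^+ d)%:E)%E.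
  rewrite [RHS]integral_mkcond; apply: eq_integral => y _.
  rewrite patchE mem_setE in_itv /= mul1r.
  have [sy|] := ltP s y; last by rewrite mulr0.
  rewrite mulr1 /hpow sqrt_subr_sqr_le // sqrtr1 (le_trans s1 (ltW sy)) /=.
  by case: ifP => //; rewrite mulr0.
under eq_integral do rewrite EFinM.
rewrite ge0_integralZl_EFin //.
- rewrite integral_itv_obnd_cbnd; last first.
    apply/measurable_EFinP; apply: measurable_funTS.
    by apply: continuous_measurable_fun; exact: continuous_sqrt_onem_sqr.
  rewrite (EFinM (kappa R d)) /cap_integral /Rintegral fineK //.
  apply: integrable_fin_num => //.
  by apply: continuous_integrable_itv; exact: continuous_sqrt_onem_sqr.
- apply/measurable_EFinP; apply: measurable_funTS.
  by apply: continuous_measurable_fun; exact: continuous_sqrt_onem_sqr.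
- exact: kappa_ge0.
Qed.

Lemma cap_integral_ge0 (R : realType) (d : nat) (s : R) : 0 <= cap_integral d s.
Proof. by apply: Rintegral_ge0 => y _; rewrite exprn_ge0 // sqrtr_ge0. Qed.

(** The reflection y -> -y cuts the Wallis integral into two equal halves. This gives the
    probability of h <= 0. *)
Lemma kappa_cap_integral0 (R : realType) (d : nat) :
  kappa R d * cap_integral d 0 = kappa R d.+1 / 2.
Proof.
pose G (y : R) := Num.sqrt (1 - y ^+ 2) ^+ d.
have cG : continuous G by exact: continuous_sqrt_onem_sqr.
have iG a b : lebesgue_measure.-integrable `[a, b] (EFin \o G).
  exact: continuous_integrable_itv.
suff e : wallis R d.+1 = cap_integral d 0 + cap_integral d 0.
  by rewrite kappaS e; field.
have h := integral_hpow d (1 : R).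
have : \int[lebesgue_measure]_(y in `[-1, 1]) G y = wallis R d.+1.
  transitivity (fine (\int[lebesgue_measure]_y (hpow d (1 - y ^+ 2 : R))%:E)%E).
    rewrite /Rintegral [in LHS]integral_mkcond; congr fine; apply: eq_integral => y _.
    rewrite patchE mem_setE in_itv /= /hpow sqrt_subr_sqr_le // sqrtr1.
    by case: ifP.
  by rewrite h /= /hpow ler01 sqrtr1 expr1n mulr1.
move=> <-.
have -> : `[-1, 1]%classic = `[-1, 0] `|` `]0, 1] :> set R.
  by rewrite -itv_bndbnd_setU // bnd_simp // ?lerN10.
rewrite Rintegral_setU //=; last 2 first.
- by apply: integrableS (iG (-1) 1) => //; rewrite -itv_bndbnd_setU ?bnd_simp ?lerN10.
- apply/disj_setPLR => y /=; rewrite !in_itv /= => /andP[_ y0]; apply/negP.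
  by rewrite negb_and -leNgt y0.
congr (_ + _); last first.
  rewrite Rintegral_itv_obnd_cbnd //.
  by apply: integrableS (iG 0 1) => //; apply: subset_itvr; rewrite bnd_simp.
rewrite -{1}oppr0 /Rintegral integration_by_substitution_oppr //.
  by congr fine; apply: eq_integral => y _; rewrite /= /G sqrrN.
exact: continuous_subspaceT.
Qed.

(* The integrand is the derivative of y |-> - (1 - y^2)^((d+2)/2) / y. *)
Lemma cap_integral_identity (R : realType) (d : nat) (s : R) : 0 < s -> s < 1 ->
  \int[lebesgue_measure]_(y in `[s, 1])
    (d.+2%:R * Num.sqrt (1 - y ^+ 2) ^+ d + Num.sqrt (1 - y ^+ 2) ^+ d.+2 / y ^+ 2)
  = Num.sqrt (1 - s ^+ 2) ^+ d.+2 / s.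
Proof.
move=> s0 s1.
pose F (y : R) := - (Num.sqrt (1 - y ^+ 2) ^+ d.+2 * y^-1).
have cF (y : R) : 0 < y -> {for y, continuous F}.
  move=> y0; apply: cvgN; apply: cvgM; first exact: continuous_sqrt_onem_sqr.
  by apply: cvgV; [rewrite gt_eqF|exact: cvg_id].
(* The endpoint 1 is left out because the square root is not differentiable at 0; continuity of [F]
   suffices there. *)
have dF (y : R) : y \in `]s, 1[ -> is_derive y 1 F
    (d.+2%:R * Num.sqrt (1 - y ^+ 2) ^+ d + Num.sqrt (1 - y ^+ 2) ^+ d.+2 / y ^+ 2).
  rewrite in_itv /= => /andP[sy y1].
  have y0 : 0 < y by exact: lt_trans sy.
  have v0 : 0 < 1 - y ^+ 2 by rewrite subr_gt0 expr_lt1 // ltW.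
  have w0 : Num.sqrt (1 - y ^+ 2) != 0 by rewrite gt_eqF // sqrtr_gt0.
  have dv : is_derive y 1 (fun y : R => 1 - y ^+ 2) (- (2 * y)).
    have -> : (fun y : R => 1 - y ^+ 2) = cst 1 - (@idfun R) ^+ 2.
      by apply/funext => z; rewrite !fctE.
    by apply: is_derive_eq; rewrite /GRing.scale /= expr1 mulr1 sub0r.
  have dw := @is_derive1_comp R Num.sqrt (fun y => 1 - y ^+ 2) y _ _
    (is_derive1_sqrt v0) dv.
  have dX : is_derive y 1 (fun y : R => Num.sqrt (1 - y ^+ 2) ^+ d.+2)
      (- (d.+2%:R * y * Num.sqrt (1 - y ^+ 2) ^+ d)).
    have -> : (fun y : R => Num.sqrt (1 - y ^+ 2) ^+ d.+2) =
        (Num.sqrt \o (fun y : R => 1 - y ^+ 2)) ^+ d.+2.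
      by apply/funext => z; rewrite exprfctE.
    apply: (is_derive_eq (is_deriveX d.+2 dw)); rewrite /GRing.scale /= exprS.
    by field.
  have yn0 : id y != 0 by rewrite gt_eqF.
  have dV : is_derive y 1 (fun y : R => y^-1) (- (y ^+ 2)^-1).
    by apply: (is_derive_eq (is_deriveV yn0 (is_derive_id y 1)));
      rewrite /GRing.scale /= mulr1.
  apply: (is_derive_eq (is_deriveN (is_deriveM dX dV))); rewrite /GRing.scale /=.
  by field; rewrite gt_eqF.
rewrite /Rintegral (@continuous_FTC2 _ _ F) //.
- by rewrite /F expr1n subrr sqrtr0 expr0n mul0r oppr0 /= sub0r opprK.
- apply: continuous_in_subspaceT => y; rewrite inE /= in_itv /= => /andP[sy _].
  have y0 : 0 < y by exact: lt_le_trans sy.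
  apply: cvgD; first by apply: cvgM; [exact: cvg_cst|exact: continuous_sqrt_onem_sqr].
  apply: cvgM; first exact: continuous_sqrt_onem_sqr.
  by apply: cvgV; [rewrite gt_eqF // exprn_gt0|exact: exprn_continuous].
- split.
  + by move=> y /dF[].
  + by apply: cvg_at_right_filter; exact: cF.
  + by apply: cvg_at_left_filter; apply: cF.
- by move=> y /dF dFy; rewrite derive1E derive_val.
Qed.

(** On [s, 1] the second term of the identity is (1 - y^2) / y^2 times (1 - y^2)^(d/2), and that
    factor lies between 0 and its value at s. *)
Lemma cap_integral_bounds (R : realType) (d : nat) (s : R) : 0 < s -> s < 1 ->
  d.+2%:R * cap_integral d s <= Num.sqrt (1 - s ^+ 2) ^+ d.+2 / s <=
  (d.+2%:R + (1 - s ^+ 2) / s ^+ 2) * cap_integral d s.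
Proof.
move=> s0 s1; rewrite -(cap_integral_identity d s0 s1) /cap_integral.
pose w (y : R) := Num.sqrt (1 - y ^+ 2).
have iw c : lebesgue_measure.-integrable `[s, 1] (EFin \o (fun y => c * w y ^+ d)).
  apply: continuous_integrable_itv => y.
  by apply: cvgM; [exact: cvg_cst|exact: continuous_sqrt_onem_sqr].
have iw1 : lebesgue_measure.-integrable `[s, 1] (EFin \o (fun y => w y ^+ d)).
  by apply: continuous_integrable_itv; exact: continuous_sqrt_onem_sqr.
have iF : lebesgue_measure.-integrable `[s, 1]
    (EFin \o (fun y => d.+2%:R * w y ^+ d + w y ^+ d.+2 / y ^+ 2)).
  apply: continuous_compact_integrable; first exact: segment_compact.
  apply: continuous_in_subspaceT => y; rewrite inE /= in_itv /= => /andP[sy _].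
  have y0 : 0 < y by exact: lt_le_trans sy.
  apply: cvgD; first by apply: cvgM; [exact: cvg_cst|exact: continuous_sqrt_onem_sqr].
  apply: cvgM; first exact: continuous_sqrt_onem_sqr.
  by apply: cvgV; [rewrite gt_eqF // exprn_gt0|exact: exprn_continuous].
rewrite -!RintegralZl //; apply/andP; split; apply: le_Rintegral => //.
- by move=> y _; rewrite lerDl divr_ge0 ?sqr_ge0 // exprn_ge0 // sqrtr_ge0.
- move=> y /=; rewrite in_itv /= => /andP[sy y1].
  have y0 : 0 < y by exact: lt_le_trans sy.
  have v0 : 0 <= 1 - y ^+ 2 by rewrite subr_ge0 expr_le1 // ltW.
  have -> : w y ^+ d.+2 = (1 - y ^+ 2) * w y ^+ d.
    by rewrite -[X in X * _](sqr_sqrtr v0) -exprD.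
  rewrite [leRHS]mulrDl lerD2l mulrAC ler_wpM2r ?exprn_ge0 ?sqrtr_ge0 // ler_pM //.
  + by rewrite invr_ge0 sqr_ge0.
  + by rewrite lerB // lerXn2r // nnegrE ltW.
  + by rewrite lef_pV2 ?posrE ?exprn_gt0 // lerXn2r // nnegrE ltW.
Qed.

(** * The distribution of the support function *)

Lemma continuous_dotprod (R : realType) (d : nat) (u : 'rV[R]_d) :
  continuous (dotprod u).
Proof.
apply: (@continuous_big R _ +%R 0 xpredT).
  exact: add_continuous.
move=> i _ x; apply: (@continuous_comp _ R R (fun x : 'rV[R]_d => x 0 i) ( *%R (u 0 i))).
  exact: coord_continuous.
exact: mulrl_continuous.
Qed.

Lemma continuous_dotprod_self (R : realType) (d : nat) :
  continuous (fun x : 'rV[R]_d => dotprod x x).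
Proof.
apply: (@continuous_big R _ +%R 0 xpredT).
  exact: add_continuous.
move=> i _ x; have c : continuous (fun x : 'rV[R]_d => x 0 i).
  exact: coord_continuous.
exact: (cvgM (c x) (c x)).
Qed.

Lemma borel_cap (R : realType) (d : nat) (u : 'rV[R]_d) (s : R) :
  borel [set x | dotprod x x <= 1 /\ s < dotprod u x].
Proof.
have opn (f : 'rV[R]_d -> R) (a : R) : continuous f ->
    measurable ([set x | a < f x] : set (g_sigma_algebraType
      [set A : set 'rV[R]_d | open A])).
  move=> cf; apply: sub_sigma_algebra => /=.
  by apply: (@open_comp _ _ f [set x | a < x]) => //; exact: open_gt.
rewrite /borel; have -> : [set x | dotprod x x <= 1 /\ s < dotprod u x] =
   ~` [set x : 'rV[R]_d | 1 < dotprod x x] `&` [set x | s < dotprod u x].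
  by apply/seteqP; split => x /= [h1 h2]; split => //;
    [rewrite ltNge h1|rewrite leNgt; exact/negP].
apply: (@measurableI _ (g_sigma_algebraType [set A : set 'rV[R]_d | open A])).
  by apply: measurableC; apply: opn; exact: continuous_dotprod_self.
by apply: opn; exact: continuous_dotprod.
Qed.

Lemma counting_eq0 (T : choiceType) (R : realType) (A : set T) :
  (@counting T R A = 0) <-> A = set0.
Proof.
split=> [|->]; last by rewrite /counting asboolT // fset_set0.
rewrite /counting; case: ifPn => // /asboolP fA [] /eqP.
by rewrite pnatr_eq0 finmap.cardfs_eq0 => /eqP /(fset_set_set0 fA).
Qed.

Lemma poisson_prob_set0 (R : realType) (r : R) : 0 <= r ->
  poisson_prob r 0%N [set 0%N] = (expR (- r))%:E.
Proof.
rewrite le_eqVlt => /predU1P[<-|r0]; rewrite /poisson_prob.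
  by rewrite ltxx diracE mem_set // oppr0 expR0.
rewrite r0 esum_set1 ?lee_fin ?poisson_pmf_ge0 // /poisson_pmf r0.
by rewrite expr0 fact0 invr1 !mul1r.
Qed.

Lemma unit_ballE (R : realType) (d : nat) (x : 'rV[R]_d) :
  unit_ball x <-> dotprod x x <= 1.
Proof.
by rewrite /unit_ball /= /enorm -{1}sqrtr1 ler_sqrt.
Qed.

Lemma dotprod_conv (R : realType) (d : nat) (u x y : 'rV[R]_d) (a b : R) :
  dotprod u (a *: x + b *: y) = a * dotprod u x + b * dotprod u y.
Proof.
rewrite /dotprod !mulr_sumr -big_split /=; apply: eq_bigr => i _.
by rewrite !mxE; ring.
Qed.

(** A half-space is convex, so it contains the hull as soon as it contains A. For empty A both sides
    hold, the supremum being -oo. *)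
Lemma support_fun_convex_hull_le (R : realType) (d : nat) (u : 'rV[R]_d)
    (A : set 'rV[R]_d) (s : R) :
  (support_fun (convex_hull A) u <= s%:E)%E <-> (forall x, A x -> dotprod u x <= s).
Proof.
split => [/ereal_supP h x Ax|h].
  rewrite -lee_fin; apply: h; exists x => //; exact: sub_gen_smallest.
apply/ereal_supP => _ [x hx <-]; rewrite lee_fin.
apply: (hx [set x | dotprod u x <= s]); split => // y z t.
rewrite !in_setE /= => uy uz; rewrite dotprod_conv.
have t0 : 0 <= t%:num :> R by [].
have t1 : t%:num <= 1 :> R by [].
rewrite -[leRHS](_ : t%:num * s + (1 - t%:num) * s = s); last by ring.
by rewrite lerD // ler_wpM2l // subr_ge0.
Qed.

Lemma support_fun_poisson_polytope_le (T : Type) (R : realType) (d : nat)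
    (X : T -> set 'rV[R]_d) (u : 'rV[R]_d) (s : R) (w : T) :
  (support_fun (poisson_polytope X w) u <= s%:E)%E <->
  counting (X w `&` [set x | dotprod x x <= 1 /\ s < dotprod u x]) = 0 :> \bar R.
Proof.
rewrite counting_eq0 support_fun_convex_hull_le; split => [h|h x [Xx /unit_ballE x1]].
  apply/seteqP; split => // x [Xx [/unit_ballE x1]]; rewrite ltNge => /negP; apply.
  exact: h.
by rewrite leNgt; apply/negP => sx; suff : set0 x by []; rewrite -h.
Qed.

(** The events h > s generate, and each is the complement of the event that a Borel cap contains no
    point; so measurability of the counts is enough. *)
Lemma measurable_support_fun (disp : measure_display) (T : measurableType disp)
    (R : realType) (P : probability T R) (d : nat) (lambda : R)
    (X : T -> set 'rV[R]_d) (u : 'rV[R]_d) :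
  poisson_process P lambda X ->
  measurable_fun setT (fun w => support_fun (poisson_polytope X w) u).
Proof.
move=> [mX _ _]; apply: (measurability _ (ErealGenOInfty.measurableE R)) => //.
move=> _ [_ [s ->] <-]; rewrite setTI.
have -> : (fun w => support_fun (poisson_polytope X w) u) @^-1` `]s%:E, +oo[ =
   ~` ((fun w => counting (X w `&` [set x | dotprod x x <= 1 /\ s < dotprod u x]))
       @^-1` [set 0%E : \bar R]).
  apply/seteqP; split => w /=.
    by rewrite in_itv /= andbT => h /support_fun_poisson_polytope_le; rewrite leNgt h.
  by move=> h; rewrite in_itv /= andbT ltNge; apply/negP => /support_fun_poisson_polytope_le.
apply: measurableC; rewrite -[X in measurable X]setTI.
by apply: mX => //; exact: borel_cap.
Qed.

Lemma probability_support_fun_le (disp : measure_display) (T : measurableType disp)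
    (R : realType) (P : probability T R) (d : nat) (lambda : R)
    (X : T -> set 'rV[R]_d.+1) (u : 'rV[R]_d.+1) (s : R) :
  poisson_process P lambda X -> 0 < lambda -> enorm u = 1 -> -1 <= s ->
  P [set w | (support_fun (poisson_polytope X w) u <= s%:E)%E] =
  (expR (- (lambda * (kappa R d * cap_integral d s))))%:E.
Proof.
move=> [_ lawX _] l0 u1 s1.
have vol := volume_unit_cap u1 s1.
transitivity (P [set w | counting (X w `&` [set x | dotprod x x <= 1 /\ s < dotprod u x])
    = 0%:R%:E :> \bar R]).
  congr (P _); apply/seteqP; split => w /=;
  by move/support_fun_poisson_polytope_le.
rewrite lawX; last 2 first.
- exact: borel_cap.
- by rewrite vol ltry.
rewrite vol poisson_prob_set0 //=; apply: mulr_ge0; first exact: ltW.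
by apply: mulr_ge0; [exact: kappa_ge0|exact: cap_integral_ge0].
Qed.

Lemma measurable_rescaled_support (R : realType) (x : \bar R) (lk : R) (d : nat) :
  measurable_fun setT (rescaled_support x lk d).
Proof.
apply: measurable_funD => //; apply: measurable_funM => //.
apply: measurable_funB => //; apply: (measurableT_comp (@measurable_ln R)).
apply: measurable_funM => //.
(* Inversion is not continuous at 0, but the power of exponent -1 is measurable everywhere and also
   takes the value 0 at 0. *)
have -> : (fun h => (Num.sqrt (1 - fine h ^+ 2))^-1) =
    (fun h : \bar R => Num.sqrt (1 - fine h ^+ 2) `^ (-1)).
  by apply/funext => h; rewrite powR_inv1 // sqrtr_ge0.
apply: (measurableT_comp (@measurable_powR R (-1))).
apply: (measurableT_comp (f := @Num.sqrt R)).
  by apply: continuous_measurable_fun; exact: sqrt_continuous.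
apply: measurable_funB => //; apply: measurable_funX.
exact: fine_measurable.
Qed.

(** * Asymptotics of the cap volume *)

(** In terms of b, sqrt(1 - s^2) is e^(-b), and [U] is the main term. Bounding (1 - s^2) / s^2 by 1
    / s^2 gives the relative error 1 / ((n+2) s^2), which vanishes as soon as d s^2 -> oo. *)
Lemma cap_rate_bounds (R : realType) (n : nat) (b : R) : 0 < b ->
  let s := Num.sqrt (1 - expR (- (2 * b))) in
  let U := expR (- (n.+2%:R * b)) / (s * n.+2%:R) in
  (U / (1 + (n.+2%:R * s ^+ 2)^-1) <= cap_integral n s <= U : Prop).
Proof.
move=> b0 s U.
have e0 := expR_gt0 (- (2 * b)).
have e1 : expR (- (2 * b)) < 1 by rewrite expR_lt1 oppr_lt0 mulr_gt0.
have v0 : 0 < 1 - expR (- (2 * b)) by rewrite subr_gt0.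
have s0 : 0 < s by rewrite sqrtr_gt0.
have s2 : s ^+ 2 = 1 - expR (- (2 * b)) by rewrite sqr_sqrtr // ltW.
have s1 : s < 1 by rewrite -sqrtr1 ltr_sqrt // ltrBlDr ltrDl.
have n0 : 0 < n.+2%:R :> R by [].
have wE : Num.sqrt (1 - s ^+ 2) ^+ n.+2 = expR (- (n.+2%:R * b)).
  rewrite s2 opprB addrC subrK.
  have -> : expR (- (2 * b)) = expR (- b) ^+ 2 by rewrite -expRM_natl; congr expR; ring.
  by rewrite sqrtr_sqr ger0_norm ?expR_ge0 // -expRM_natl mulrN.
have /andP[] := cap_integral_bounds n s0 s1; rewrite wE => h1 h2.
have J0 := cap_integral_ge0 n s.
apply/andP; split; last first.
  by rewrite /U invfM mulrA ler_pdivlMr // mulrC.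
rewrite ler_pdivrMr; last by rewrite addr_gt0 // invr_gt0 mulr_gt0 // exprn_gt0.
rewrite /U invfM mulrA ler_pdivrMr //; apply: (le_trans h2).
have -> : cap_integral n s * (1 + (n.+2%:R * s ^+ 2)^-1) * n.+2%:R =
    (n.+2%:R + 1 / s ^+ 2) * cap_integral n s.
  by field; rewrite -[2 + n%:R]natrD !gt_eqF.
rewrite ler_wpM2r // lerD2l ler_pM2r ?invr_gt0 ?exprn_gt0 //.
by rewrite lerBlDr lerDl sqr_ge0.
Qed.

Lemma cvg_invn (R : realType) : (fun d : nat => d%:R^-1 : R) @ \oo --> (0 : R).
Proof.
apply/gtr0_cvgV0; last exact: cvgr_idn.
by near=> n; rewrite ltr0n; near: n; exact: nbhs_infty_gt.
Unshelve. all: end_near. Qed.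

Lemma cvg_succn_divn (R : realType) :
  (fun d : nat => d.+1%:R / d%:R : R) @ \oo --> (1 : R).
Proof.
rewrite -[X in _ --> X]addr0.
have : (fun d : nat => 1 + d%:R^-1 : R) @ \oo --> (1 + 0 : R).
  by apply: cvgD; [exact: cvg_cst|exact: cvg_invn].
apply: cvg_trans; apply: near_eq_cvg; near=> d.
have d0 : 0 < d%:R :> R by rewrite ltr0n; near: d; exact: nbhs_infty_gt.
by rewrite -[d.+1%:R]natr1; field; rewrite gt_eqF.
Unshelve. all: end_near. Qed.

Lemma cvg_wallis (R : realType) :
  (fun d : nat => d.+1%:R * wallis R d ^+ 2 / (2 * pi)) @ \oo --> (1 : R).
Proof.
apply: (@squeeze_cvgr _ _ _ _ (cst 1) (fun d : nat => d.+1%:R / d%:R : R)).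
- near=> d.
  have d0 : (0 < d)%N by near: d; exact: nbhs_infty_gt.
  rewrite -(prednK d0); move: d.-1 => n.
  have p0 : 0 < 2 * pi :> R by rewrite mulr_gt0 // pi_gt0.
  have w0 := wallis_gt0 R n.+1.
  rewrite ler_pdivlMr // mul1r -{1}(wallisM R n.+1) ler_pdivrMr //.
  apply/andP; split.
    by rewrite ler_wpM2l // expr2 ler_pM2r // wallis_decreasing.
  rewrite -(wallisM R n) [leRHS]mulrA divfK ?pnatr_eq0 //.
  by rewrite ler_wpM2l // expr2 ler_pM2l // wallis_decreasing.
- exact: cvg_cst.
- exact: cvg_succn_divn.
Unshelve. all: end_near. Qed.

Lemma cvg_cap_rate (R : realType) (L m : nat -> R) (t : R) :
  let b d := ln (L d) / d.+1%:R + (t - ln (m d) / 2) / d%:R in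
  (\forall d \near \oo, 0 < L d) -> m @ \oo --> +oo ->
  (fun d => ln (m d) / d%:R) @ \oo --> (0 : R) ->
  (fun d => (1 - expR (- (2 * b d))) * (2 * pi * d.+1%:R / m d)) @ \oo --> (1 : R) ->
  (\forall d \near \oo, 0 < b d) /\
  (fun d => L d / wallis R d *
     cap_integral d.-1 (Num.sqrt (1 - expR (- (2 * b d))))) @ \oo --> expR (- t).
Proof.
move=> b L0 moo lnm hq.
set q := (fun d => _) in hq.
have p0 : 0 < 2 * pi :> R by rewrite mulr_gt0 // pi_gt0.
have m0 : \forall d \near \oo, 0 < m d by move/cvgryPgt : (moo); exact.
have q0 : \forall d \near \oo, 0 < q d.
  by near=> d; near: d; apply: (cvgr_gt 1 hq); exact: ltr01.
(* For m > 0 the sign of [q] is that of 1 - e^(-2b), hence that of b. *)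
have b0 : \forall d \near \oo, 0 < b d.
  near=> d; have : 0 < q d by near: d.
  have md : 0 < m d by near: d.
  rewrite /q pmulr_lgt0; last by rewrite divr_gt0 // mulr_gt0.
  by rewrite subr_gt0 expR_lt1 oppr_lt0 pmulr_rgt0.
split => //.
(* This is the upper bound of [cap_rate_bounds] times L / W_d, rearranged into convergent factors:
   the root equals s (d+1) W_d / sqrt m, so it absorbs the sqrt m coming from e^(-(d+1) b). *)
pose U d := expR (- (t * (d.+1%:R / d%:R))) * expR (ln (m d) / d%:R / 2)
   / Num.sqrt (q d * (d.+1%:R * wallis R d ^+ 2 / (2 * pi))).
have cU : U @ \oo --> expR (- t).
  have -> : expR (- t) = expR (- (t * 1)) * expR (0 / 2) / Num.sqrt (1 * 1) :> R.
    by rewrite !mulr1 mul0r expR0 sqrtr1 divr1 mulr1.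
  apply: cvgM; first apply: cvgM.
  - apply: (@continuous_cvg _ _ _ _ _ _ expR); first exact: continuous_expR.
    by apply: cvgN; apply: cvgM; [exact: cvg_cst|exact: cvg_succn_divn].
  - apply: (@continuous_cvg _ _ _ _ _ _ expR); first exact: continuous_expR.
    by apply: cvgM => //; exact: cvg_cst.
  - apply: cvgV; first by rewrite mulr1 sqrtr1 oner_neq0.
    apply: (@continuous_cvg _ _ _ _ _ _ Num.sqrt); first exact: sqrt_continuous.
    by apply: cvgM => //; exact: cvg_wallis.
apply: (@squeeze_cvgr _ _ _ _ (fun d => U d / (1 + 2 * pi / (q d * m d))) U) => //.
- near=> d.
  have Ld : 0 < L d by near: d.
  have md : 0 < m d by near: d.
  have qd : 0 < q d by near: d.
  have bd : 0 < b d by near: d.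
  have d0 : (0 < d)%N by near: d; exact: nbhs_infty_gt.
  move: Ld md qd bd; rewrite -(prednK d0); move: d.-1 => n Ld md qd bd.
  have := cap_rate_bounds n bd; set s := Num.sqrt _ => /= /andP[h1 h2].
  have v0 : 0 < 1 - expR (- (2 * b n.+1)).
    by rewrite subr_gt0 expR_lt1 oppr_lt0 mulr_gt0.
  have s2 : s ^+ 2 = 1 - expR (- (2 * b n.+1)) by rewrite sqr_sqrtr // ltW.
  have s0 : 0 < s by rewrite sqrtr_gt0.
  have w0 := wallis_gt0 R n.+1.
  have n20 : 0 < n.+2%:R :> R by [].
  have n10 : 0 < n.+1%:R :> R by [].
  have qm : q n.+1 * m n.+1 = 2 * pi * (n.+2%:R * s ^+ 2).
    by rewrite /q s2; field; rewrite gt_eqF.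
  have UE : U n.+1 = L n.+1 / wallis R n.+1 * (expR (- (n.+2%:R * b n.+1)) / (s * n.+2%:R)).
    set M := ln (m n.+1).
    have mE : m n.+1 = expR (M / 2) ^+ 2.
      rewrite -expRM_natl mulrC divfK ?pnatr_eq0 // lnK //.
    have e0 := expR_gt0 (M / 2).
    have -> : U n.+1 = expR (- (t * (n.+2%:R / n.+1%:R))) * expR (M / n.+1%:R / 2)
        * expR (M / 2) / (s * n.+2%:R * wallis R n.+1).
      rewrite /U -/M.
      have -> : q n.+1 * (n.+2%:R * wallis R n.+1 ^+ 2 / (2 * pi)) =
          (s * n.+2%:R * wallis R n.+1 / expR (M / 2)) ^+ 2.
        rewrite /q -s2 mE; move: (2 * pi) p0 => p p0.
        by field; rewrite !gt_eqF.
      rewrite sqrtr_sqr ger0_norm; last by rewrite divr_ge0 ?mulr_ge0 // ltW.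
      by field; rewrite -[2 + n%:R]natrD !gt_eqF.
    rewrite -!expRD -{1}(lnK Ld).
    rewrite [RHS](_ : _ = expR (ln (L n.+1)) * expR (- (n.+2%:R * b n.+1)) /
        (s * n.+2%:R * wallis R n.+1)); last first.
      by field; rewrite -[2 + n%:R]natrD !gt_eqF.
    rewrite -expRD; congr (expR _ / _); rewrite /b -/M.
    by field; rewrite nat1r -[2 + n%:R]natrD !pnatr_eq0.
  have -> : 2 * pi / (q n.+1 * m n.+1) = (n.+2%:R * s ^+ 2)^-1.
    by rewrite qm invfM mulrA divff ?mul1r // gt_eqF.
  have LW : 0 < L n.+1 / wallis R n.+1 by rewrite divr_gt0.
  by rewrite UE ler_pM2l // -mulrA ler_pM2l // h1.
- rewrite -[X in _ --> X]divr1; apply: cvgM => //; apply: cvgV; first exact: oner_neq0.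
  rewrite -[X in _ --> X]addr0; apply: cvgD; first exact: cvg_cst.
  rewrite -(mulr0 (2 * pi)); apply: cvgM; first exact: cvg_cst.
  apply/gtr0_cvgV0.
    by near=> d; rewrite mulr_gt0 //; near: d.
  apply/cvgryPge => A; near=> d.
  have qd : 1 / 2 < q d.
    by near: d; apply: (cvgr_gt 1 hq); rewrite ltr_pdivrMr // mul1r ltr1n.
  have md : 2 * `|A| <= m d by near: d; move/cvgryPge : (moo); exact.
  apply: (le_trans (ler_norm A)); rewrite -[leLHS](_ : 1 / 2 * (2 * `|A|) = _); last by field.
  by apply: ler_pM => //; exact: ltW.
Unshelve. all: end_near. Qed.

(** * Growth of m(d) in the three regimes *)

Lemma near_limn_einf_gt (R : realType) (v : nat -> R) (a : R) :
  (a%:E < limn_einf (fun d => (v d)%:E))%E -> \forall d \near \oo, a < v d.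
Proof.
rewrite limn_einf_lim (cvg_lim _ (@cvg_einfs_sup R (fun d => (v d)%:E))) //.
move=> /ereal_sup_gt [_ [n _ <-] an]; exists n => // d /= nd.
rewrite -lte_fin; apply: (lt_le_trans an).
by apply: ereal_inf_lbound; exists d.
Qed.

Lemma cvgry_ln (R : realType) (f : nat -> R) :
  f @ \oo --> +oo -> (fun d => ln (f d)) @ \oo --> +oo.
Proof.
move=> /cvgryPge foo; apply/cvgryPge => A; near=> d.
have h : expR A <= f d by near: d; exact: foo.
by rewrite -(expRK A) ler_ln // posrE ?expR_gt0 // (lt_le_trans _ h) ?expR_gt0.
Unshelve. all: end_near. Qed.

(** Writing ln f = 2 ln(sqrt f) <= 2 sqrt f bounds the quotient by 2 / sqrt f. *)
Lemma cvg_ln_divr (R : realType) (f : nat -> R) :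
  f @ \oo --> +oo -> (fun d => ln (f d) / f d) @ \oo --> (0 : R).
Proof.
move=> foo.
have sqoo : (fun d => Num.sqrt (f d)) @ \oo --> +oo.
  exact: (cvg_comp f Num.sqrt foo (@cvgr_sqrt_pinfty R)).
apply: (@squeeze_cvgr _ _ _ _ (cst 0) (fun d => 2 * (Num.sqrt (f d))^-1)).
- near=> d; have f1 : 1 <= f d by near: d; move/cvgryPge : (foo); exact.
  have f0 : 0 < f d by exact: lt_le_trans f1.
  have s0 : 0 < Num.sqrt (f d) by rewrite sqrtr_gt0.
  rewrite /= divr_ge0 ?ln_ge0 ?(ltW f0) //=.
  rewrite ler_pdivrMr // -[X in _ * X](sqr_sqrtr (ltW f0)) expr2 mulrA divfK ?gt_eqF //.
  rewrite -{1}(sqr_sqrtr (ltW f0)) lnXn // mulr_natl lerMn2r /=.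
  exact/ltW/ln_sublinear.
- exact: cvg_cst.
- rewrite -(mulr0 2); apply: cvgM; first exact: cvg_cst.
  apply/gtr0_cvgV0 => //; near=> d; rewrite sqrtr_gt0.
  by near: d; move/cvgryPgt : (foo); exact.
Unshelve. all: end_near. Qed.

(** The inequality e^z >= 1 + z at z = y and at z = -y squeezes the quotient between 1 / (1 + y) and
    1. *)
Lemma cvg_onem_expRN_div (R : realType) (y : nat -> R) :
  (\forall d \near \oo, 0 < y d) -> y @ \oo --> (0 : R) ->
  (fun d => (1 - expR (- y d)) / y d) @ \oo --> (1 : R).
Proof.
move=> y0 yc.
apply: (@squeeze_cvgr _ _ _ _ (fun d => (1 + y d)^-1) (cst 1)).
- near=> d; have yd : 0 < y d by near: d.
  have yd1 : 0 < 1 + y d by rewrite addr_gt0.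
  apply/andP; split; last first.
    rewrite ler_pdivrMr // mul1r lerBlDr -lerBlDl.
    by have := expR_ge1Dx (- y d); lra.
  rewrite ler_pdivlMr // lerBrDr -lerBrDl.
  have -> : 1 - (1 + y d)^-1 * y d = (1 + y d)^-1 by field; rewrite gt_eqF.
  by rewrite expRN lef_pV2 ?posrE ?expR_gt0 // expR_ge1Dx.
- rewrite -[X in _ --> X]invr1; apply: cvgV; first exact: oner_neq0.
  by rewrite -[X in _ --> X]addr0; apply: cvgD => //; exact: cvg_cst.
- exact: cvg_cst.
Unshelve. all: end_near. Qed.

Lemma cvg_ln_divn (R : realType) (m : nat -> R) (C : R) :
  m @ \oo --> +oo -> (\forall d \near \oo, m d <= C * d%:R) ->
  (fun d => ln (m d) / d%:R) @ \oo --> (0 : R).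
Proof.
move=> moo mC.
apply: (@squeeze_cvgr _ _ _ _ (cst 0) (fun d => C * (ln (m d) / m d))).
- near=> d; have m1 : 1 <= m d by near: d; move/cvgryPge : (moo); exact.
  have m0 : 0 < m d by exact: lt_le_trans m1.
  have d0 : 0 < d%:R :> R by rewrite ltr0n; near: d; exact: nbhs_infty_gt.
  have mCd : m d <= C * d%:R by near: d.
  rewrite /= divr_ge0 ?ln_ge0 //= ler_pdivrMr // mulrAC mulrA ler_pdivlMr // mulrC.
  by rewrite ler_wpM2r // ln_ge0.
- exact: cvg_cst.
- rewrite -(mulr0 C); apply: cvgM; first exact: cvg_cst.
  exact: cvg_ln_divr.
Unshelve. all: end_near. Qed.

Lemma linear_growth (R : realType) (m : nat -> R) (c : R) : 0 < c ->
  (fun d => m d / d%:R) @ \oo --> c ->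
  m @ \oo --> +oo /\ (fun d => ln (m d) / d%:R) @ \oo --> (0 : R).
Proof.
move=> c0 mc.
have moo : m @ \oo --> +oo.
  apply/cvgryPge => A; near=> d.
  have d0 : 0 < d%:R :> R by rewrite ltr0n; near: d; exact: nbhs_infty_gt.
  have h1 : c / 2 < m d / d%:R.
    by near: d; apply: (cvgr_gt c mc); rewrite ltr_pdivrMr // ltr_pMr // ltr1n.
  have h2 : 2 * `|A| / c <= d%:R by near: d; move/cvgryPge : (@cvgr_idn R); exact.
  apply: (le_trans (ler_norm A)).
  apply: (@le_trans _ _ (c / 2 * d%:R)); last by rewrite -ler_pdivlMr // ltW.
  by rewrite mulrAC ler_pdivlMr // mulrC (mulrC c) -ler_pdivrMr.
split => //; apply: (@cvg_ln_divn _ _ (c + 1)) => //; near=> d.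
have d0 : 0 < d%:R :> R by rewrite ltr0n; near: d; exact: nbhs_infty_gt.
rewrite -ler_pdivrMr // ltW //.
by near: d; apply: (cvgr_lt c mc); rewrite ltrDl.
Unshelve. all: end_near. Qed.

Lemma cvg_shift_rate (R : realType) (m : nat -> R) (t : R) :
  (fun d => ln (m d) / d%:R) @ \oo --> (0 : R) ->
  (fun d => (t - ln (m d) / 2) / d%:R) @ \oo --> (0 : R).
Proof.
move=> h; rewrite (_ : (fun d => _) = (fun d => t * d%:R^-1 - ln (m d) / d%:R / 2)).
  rewrite -[X in _ --> X](subr0 0); apply: cvgB.
    by rewrite -(mulr0 t); apply: cvgM; [exact: cvg_cst|exact: cvg_invn].
  by rewrite -(mul0r 2^-1); apply: cvgM => //; exact: cvg_cst.
by apply/funext => d; rewrite mulrBl mulrAC.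
Qed.

Lemma cvg_divn_succn (R : realType) :
  (fun d : nat => d%:R / d.+1%:R : R) @ \oo --> (1 : R).
Proof.
rewrite (_ : (fun d => _) = (fun d : nat => (d.+1%:R / d%:R)^-1 : R)).
  by rewrite -[X in _ --> X]invr1; apply: cvgV; [exact: oner_neq0|exact: cvg_succn_divn].
by apply/funext => d; rewrite invfM invrK mulrC.
Qed.

(* The last condition says m(d) ~ 2 pi d s^2, where s^2 = 1 - e^(-2b). *)
Definition rate_conditions (R : realType) (L m : nat -> R) (t : R) :=
  [/\ m @ \oo --> +oo,
   (fun d => ln (m d) / d%:R) @ \oo --> (0 : R) &
   (fun d => (1 - expR (- (2 * (ln (L d) / d.+1%:R + (t - ln (m d) / 2) / d%:R))))
       * (2 * pi * d.+1%:R / m d)) @ \oo --> (1 : R)].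

(** This covers the critical and supercritical regimes, where s^2 has a positive limit c. The
    hypothesis allows any vanishing [e] because the actual shift (t - ln m / 2) / d involves m, and
    it tends to 0 only once the linear growth of m is known. *)
Lemma rate_conditions_linear (R : realType) (L m : nat -> R) (t c : R) : 0 < c ->
  (fun d => m d / d%:R) @ \oo --> 2 * pi * c ->
  (forall e : nat -> R, e @ \oo --> (0 : R) ->
    (fun d => expR (- (2 * (ln (L d) / d.+1%:R + e d)))) @ \oo --> 1 - c) ->
  rate_conditions L m t.
Proof.
move=> c0 mc hc.
have p0 : 0 < 2 * pi :> R by rewrite mulr_gt0 // pi_gt0.
have [moo lnm] := linear_growth (mulr_gt0 p0 c0) mc.
split => //.
have := hc _ (cvg_shift_rate t lnm); set E := (fun d => expR _) => hE.
rewrite [X in _ --> X](_ : 1 = (1 - (1 - c)) * (2 * pi / (2 * pi * c) * 1)); last first.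
  move: (2 * pi) p0 => p p0; rewrite opprB addrC subrK mulr1; field.
  by rewrite !gt_eqF.
apply: cvgM; first by apply: cvgB; [exact: cvg_cst|exact: hE].
have h : (fun d => 2 * pi / (m d / d%:R) * (d.+1%:R / d%:R)) @ \oo
    --> 2 * pi / (2 * pi * c) * 1.
  apply: cvgM; last exact: cvg_succn_divn.
  apply: cvgM; first exact: cvg_cst.
  by apply: cvgV => //; rewrite gt_eqF // mulr_gt0.
move: h; apply: cvg_trans; apply: near_eq_cvg; near=> d.
have d0 : 0 < d%:R :> R by rewrite ltr0n; near: d; exact: nbhs_infty_gt.
have m0 : 0 < m d by near: d; move/cvgryPgt : (moo); exact.
move: (2 * pi) => p; rewrite -[d.+1%:R]natr1; field.
by rewrite !gt_eqF.
Unshelve. all: end_near. Qed.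

Lemma rate_conditions_regime (R : realType) (L : nat -> R) (x : \bar R) (t : R) :
  (\forall d \near \oo, 2 * d%:R < L d) -> (0 <= x)%E ->
  (fun d : nat => (1 / d%:R * ln (L d))%:E) @ \oo --> x ->
  rate_conditions L (fun d => regime_const x (L d) d) t.
Proof.
move=> hL x0 hx.
have Loo : L @ \oo --> +oo.
  apply/cvgryPge => A; near=> d.
  have h : 2 * d%:R < L d by near: d.
  have h2 : A <= d%:R by near: d; move/cvgryPge : (@cvgr_idn R); exact.
  have d0 : 0 <= d%:R :> R by [].
  lra.
have L0 : \forall d \near \oo, 0 < L d by move/cvgryPgt : (Loo); exact.
case: x x0 hx => [r|_|//] /=.
- rewrite lee_fin => r0 /fine_cvgP [_ hr]; have {}hr : (fun d => ln (L d) / d%:R) @ \oo --> r.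
    move: hr; apply: cvg_trans; apply: near_eq_cvg; near=> d.
    by rewrite /= mul1r mulrC.
  have hr' : (fun d => ln (L d) / d.+1%:R) @ \oo --> r.
    rewrite -[X in _ --> X](mulr1 r).
    have : (fun d => ln (L d) / d%:R * (d%:R / d.+1%:R)) @ \oo --> r * 1.
      by apply: cvgM => //; exact: cvg_divn_succn.
    apply: cvg_trans; apply: near_eq_cvg; near=> d.
    have d0 : 0 < d%:R :> R by rewrite ltr0n; near: d; exact: nbhs_infty_gt.
    by rewrite mulrA divfK // gt_eqF.
  have [r00|rn0] := eqVneq r 0; last first.
    have {}r0 : 0 < r by rewrite lt_neqAle eq_sym rn0.
    apply: (@rate_conditions_linear _ _ _ _ (1 - expR (- (2 * r)))).
    + by rewrite subr_gt0 expR_lt1 oppr_lt0 mulr_gt0.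
    + apply: cvg_near_cst; near=> d.
      have d0 : 0 < d%:R :> R by rewrite ltr0n; near: d; exact: nbhs_infty_gt.
      by rewrite (mulrAC _ d%:R) mulfK // gt_eqF.
    + move=> e he; rewrite opprB addrC subrK.
      apply: (@continuous_cvg _ _ _ _ _ _ expR); first exact: continuous_expR.
      apply: cvgN; apply: cvgM; first exact: cvg_cst.
      by rewrite -[X in _ --> X](addr0 r); exact: cvgD.
  (* In the subcritical regime s^2 -> 0, so a limit is not enough: 1 - e^(-2b) ~ 2b and b (d+1) ~ ln
     L give 2 pi (d+1) s^2 ~ 4 pi ln L = m. *)
  move: hr hr'; rewrite r00 => hr hr'.
  have lnoo := cvgry_ln Loo.
  have p0 : 0 < 4 * pi :> R by rewrite mulr_gt0 // pi_gt0.
  have moo : (fun d => 4 * pi * ln (L d)) @ \oo --> +oo.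
    apply/cvgryPge => A; near=> d.
    have h : A / (4 * pi) <= ln (L d) by near: d; move/cvgryPge : (lnoo); exact.
    by rewrite mulrC -ler_pdivrMr.
  have lnm : (fun d => ln (4 * pi * ln (L d)) / d%:R) @ \oo --> (0 : R).
    apply: (@cvg_ln_divn _ _ (4 * pi)) => //; near=> d.
    have d0 : 0 < d%:R :> R by rewrite ltr0n; near: d; exact: nbhs_infty_gt.
    have h : ln (L d) / d%:R < 1 by near: d; apply: (cvgr_lt 0 hr).
    by rewrite ler_pM2l // ltW // -[ltRHS]mul1r -ltr_pdivrMr.
  have p20 : 4 * pi = 2 * (2 * pi) :> R by rewrite mulrA -natrM.
  split => //; have hs := cvg_shift_rate t lnm.
  pose b d := ln (L d) / d.+1%:R + (t - ln (4 * pi * ln (L d)) / 2) / d%:R.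
  have hb : b @ \oo --> (0 : R) by rewrite -[X in _ --> X](addr0 0); exact: cvgD.
  (* The shift contributes ln m / (2 ln L) = (4 pi / 2) (ln m / m), as m = 4 pi ln L; this vanishes
     since m -> oo. *)
  have hbL : (fun d => b d * d.+1%:R / ln (L d)) @ \oo --> (1 : R).
    have h : (fun d => 1 + d.+1%:R / d%:R * (t * (ln (L d))^-1 -
         (4 * pi) / 2 * (ln (4 * pi * ln (L d)) / (4 * pi * ln (L d))))) @ \oo -->
         1 + 1 * (t * 0 - (4 * pi) / 2 * 0).
      apply: cvgD; first exact: cvg_cst.
      apply: cvgM; first exact: cvg_succn_divn.
      apply: cvgB; last by apply: cvgM; [exact: cvg_cst|exact: cvg_ln_divr].
      apply: cvgM; first exact: cvg_cst.
      by apply/gtr0_cvgV0 => //; move/cvgryPgt : (lnoo); exact.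
    move: h; rewrite !mulr0 subr0 mulr0 addr0; apply: cvg_trans; apply: near_eq_cvg; near=> d.
    have d0 : 0 < d%:R :> R by rewrite ltr0n; near: d; exact: nbhs_infty_gt.
    have l0 : 0 < ln (L d) by near: d; move/cvgryPgt : (lnoo); exact.
    rewrite /b; move: (4 * pi) p0 => p p0; move: (ln (p * _)) => lm.
    by rewrite -[d.+1%:R]natr1; field; rewrite natr1 (pnatr_eq0 R d.+1) !gt_eqF.
  have b0 : \forall d \near \oo, 0 < b d.
    near=> d.
    have l0 : 0 < ln (L d) by near: d; move/cvgryPgt : (lnoo); exact.
    have : 0 < b d * d.+1%:R / ln (L d) by near: d; apply: (cvgr_gt 1 hbL).
    by rewrite pmulr_lgt0 ?invr_gt0 // pmulr_lgt0.
  have h1 : (fun d => (1 - expR (- (2 * b d))) / (2 * b d) * (b d * d.+1%:R / ln (L d)))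
      @ \oo --> 1 * (1 : R).
    apply: cvgM => //; apply: cvg_onem_expRN_div.
      by near=> d; rewrite mulr_gt0 //; near: d.
    by rewrite -(mulr0 2); apply: cvgM => //; exact: cvg_cst.
  rewrite -[X in _ --> X]mulr1; move: h1; apply: cvg_trans; apply: near_eq_cvg; near=> d.
  have l0 : 0 < ln (L d) by near: d; move/cvgryPgt : (lnoo); exact.
  have bd : 0 < b d by near: d.
  have q0 : 0 < 2 * pi :> R by rewrite mulr_gt0 // pi_gt0.
  rewrite -/(b d) p20; move: (2 * pi) q0 => q q0; move: (1 - expR _) => E.
  by field; rewrite !gt_eqF.
(* In the supercritical regime m / (2 pi d) is s^2 with the shift dropped, and it tends to 1 with or
   without the shift. *)
- move=> /cvgeryP hy.
  pose c d := 1 - L d `^ (- (2 / (d%:R + 1))).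
  have e0 (e : nat -> R) : e @ \oo --> (0 : R) ->
    (fun d => expR (- (2 * (ln (L d) / d.+1%:R + e d)))) @ \oo --> (0 : R).
    move=> he.
    have : (fun d => 2 * (ln (L d) / d.+1%:R + e d)) @ \oo --> +oo.
      apply/cvgryPge => A; near=> d.
      have d0 : 0 < d%:R :> R by rewrite ltr0n; near: d; exact: nbhs_infty_gt.
      have d1 : 1 <= d%:R :> R by rewrite ler1n -(ltr0n R).
      have h1 : -1 < e d by near: d; apply: (cvgr_gt 0 he); rewrite oppr_lt0.
      (* The factor 2 pays for d + 1 <= 2 d, the summand 1 for e d > -1. *)
      have h2 : 2 * (`|A| + 1) <= 1 / d%:R * ln (L d) by near: d; move/cvgryPge : (hy); exact.
      have h3 : `|A| + 1 <= ln (L d) / d.+1%:R.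
        rewrite ler_pdivlMr //; move: h2; rewrite mul1r [leRHS]mulrC ler_pdivlMr // => h2.
        apply: le_trans h2; rewrite -[d.+1%:R]natr1.
        by have := normr_ge0 A; nra.
      have := ler_norm A; have := normr_ge0 A.
      by move: (ln (L d) / _) (e d) h1 h3 => l ed h1 h3; move: `|A| h3 => a; lra.
    by move=> h; exact: (cvg_comp _ (fun y => expR (- y)) h (@cvgr_expR R)).
  apply: (@rate_conditions_linear _ _ _ _ 1) => //; last first.
    by move=> e he; rewrite subrr; exact: e0.
  rewrite mulr1 -[X in _ --> X]mulr1.
  have hc : c @ \oo --> (1 : R).
    have h : (fun d => L d `^ (- (2 / (d%:R + 1)))) @ \oo --> (0 : R).
      have z0 : (fun=> 0 : R) @ \oo --> (0 : R) by exact: cvg_cst.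
      have := e0 _ z0; apply: cvg_trans; apply: near_eq_cvg; near=> d.
      have Ld : 0 < L d by near: d.
      rewrite /powR gt_eqF //= addr0 natr1; congr expR; field.
      by rewrite nat1r pnatr_eq0.
    by rewrite -[X in _ --> X](subr0 1); apply: cvgB => //; exact: cvg_cst.
  have : (fun d => 2 * pi * c d) @ \oo --> 2 * pi * (1 : R).
    by apply: cvgM => //; exact: cvg_cst.
  apply: cvg_trans; apply: near_eq_cvg; near=> d.
  have d0 : 0 < d%:R :> R by rewrite ltr0n; near: d; exact: nbhs_infty_gt.
  by rewrite /c (mulrAC _ d%:R) mulfK // gt_eqF.
Unshelve. all: end_near. Qed.
(** * Convergence in distribution *)

Lemma ln_sqrt (R : realType) (v : R) : 0 < v -> ln (Num.sqrt v) = ln v / 2.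
Proof.
move=> v0; rewrite -[in RHS](sqr_sqrtr (ltW v0)) lnXn ?sqrtr_gt0 //.
by rewrite mulr2n mulrDl -splitr.
Qed.

(** On [0, 1) the rescaled variable increases with h, and b is the value of -ln(sqrt(1 - h^2)) at
    which it equals t. *)
Lemma rescaled_support_le (R : realType) (x : \bar R) (lk : R) (d : nat) (t h : R) :
  (0 < d)%N -> 0 < regime_const x lk d ->
  let b := ln lk / d.+1%:R + (t - ln (regime_const x lk d) / 2) / d%:R in
  0 < b -> 0 <= h -> h < 1 ->
  (rescaled_support x lk d h%:E <= t) = (h <= Num.sqrt (1 - expR (- (2 * b)))).
Proof.
move=> d0 m0 b b0 h0 h1.
have {}d0 : 0 < d%:R :> R by rewrite ltr0n.
have v0 : 0 < 1 - h ^+ 2 by rewrite subr_gt0 expr_lt1.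
have w0 : 0 < Num.sqrt (1 - h ^+ 2) by rewrite sqrtr_gt0.
have e1 : expR (- (2 * b)) < 1 by rewrite expR_lt1 oppr_lt0 mulr_gt0.
rewrite /rescaled_support /=.
rewrite (ln_sqrt m0) {1}div1r lnV ?posrE // (ln_sqrt v0).
rewrite -lerBrDr mulrC -ler_pdivlMr // lerBlDr natr1 mul1r [_^-1 * _]mulrC [leRHS]addrC -/b.
rewrite lerNl ler_pdivlMr // mulNr [b * 2]mulrC -[leLHS]expRK ler_ln ?posrE ?expR_gt0 //.
rewrite lerBrDr -lerBrDl -[in RHS](ger0_norm h0) -sqrtr_sqr ler_sqrt //.
by rewrite subr_ge0 ltW.
Qed.

Lemma cap_integral_le (R : realType) (d : nat) (s : R) : 0 <= s <= 1 ->
  cap_integral d s <= 1 - s.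
Proof.
move=> /andP[s0 s1].
apply: (@le_trans _ _ (\int[lebesgue_measure]_(y in `[s, 1]) (1 : R))).
  apply: le_Rintegral => //.
  - by apply: continuous_integrable_itv; exact: continuous_sqrt_onem_sqr.
  - by apply: continuous_integrable_itv; exact: cst_continuous.
  - move=> y _; rewrite exprn_ile1 ?sqrtr_ge0 // -sqrtr1 ler_sqrt //.
    by rewrite sqrtr1 lerBlDr lerDl sqr_ge0.
rewrite Rintegral_cst //= lebesgue_measure_itv /= lte_fin mul1r.
by case: ltP => //= _; rewrite subr_ge0.
Qed.

(* At h = 1 the convention 1 / 0 = 0 gives the rescaled variable a junk value that
   is too small, so this event has to be discarded separately. *)
Lemma probability_support_fun_ge1 (disp : measure_display) (T : measurableType disp)
    (R : realType) (P : probability T R) (d : nat) (lambda : R)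
    (X : T -> set 'rV[R]_d.+1) (u : 'rV[R]_d.+1) :
  poisson_process P lambda X -> 0 < lambda -> enorm u = 1 ->
  P [set w | (1 <= support_fun (poisson_polytope X w) u)%E] = 0%E.
Proof.
move=> hX l0 u1; have mh := measurable_support_fun u hX.
pose h w := support_fun (poisson_polytope X w) u.
set A := [set w | _].
have mA : measurable A.
  by rewrite -[X in measurable X]setTI; exact: emeasurable_fun_c_infty.
have pE : P A = (fine (P A))%:E by rewrite fineK // fin_num_measure.
have p0 : 0 <= fine (P A) by rewrite fine_ge0.
move: p0; rewrite le_eqVlt => /predU1P[p0|p0]; first by rewrite pE -p0.
exfalso.
set p := fine (P A) in p0 pE.
pose c := lambda * kappa R d.
have c0 : 0 < c by rewrite mulr_gt0 ?kappa_gt0.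
(* The event lies in h > 1 - e, whose probability 1 - e^(-v) is at most the mean v of the cap, and
   the cap integral is at most e. *)
have hp e : 0 < e -> e <= 1 -> p <= c * e.
  move=> e0 e1.
  have mB : measurable [set w | (h w <= (1 - e)%:E)%E].
    by rewrite -[X in measurable X]setTI; exact: emeasurable_fun_infty_c.
  have : (P A <= P (~` [set w | (h w <= (1 - e)%:E)%E]))%E.
    apply: le_measure; rewrite ?inE //; first exact: measurableC.
    move=> w; rewrite /A /= => h1; apply/negP; rewrite -ltNge; apply: lt_le_trans h1.
    by rewrite lte_fin ltrBlDr ltrDl.
  rewrite probability_setC // (probability_support_fun_le hX l0 u1); last first.
    by rewrite lerBrDl; lra.
  rewrite pE -EFinB lee_fin => /le_trans; apply.
  rewrite lerBlDr.
  have := expR_ge1Dx (- (lambda * (kappa R d * cap_integral d (1 - e)))).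
  have : cap_integral d (1 - e) <= 1 - (1 - e).
    by apply: cap_integral_le; apply/andP; split; lra.
  rewrite opprB addrCA subrr addr0 mulrA -/c => J1.
  have : c * cap_integral d (1 - e) <= c * e by rewrite ler_pM2l.
  by move: (expR _) => E; lra.
(* The choice e = p / (2 (c + p)) is at most 1 and satisfies c e < p, a contradiction. *)
have cp : 0 < 2 * (c + p) by rewrite mulr_gt0 // addr_gt0.
have e1 : p / (2 * (c + p)) <= 1 by rewrite ler_pdivrMr //; lra.
have := hp _ (divr_gt0 p0 cp) e1; rewrite mulrA ler_pdivlMr //.
by have := mulr_gt0 c0 p0; have := mulr_gt0 p0 p0; nra.
Qed.

(** On 0 <= h < 1 the events Y <= t and h <= s coincide. Since s < 1, the second lies in the first
    up to h <= 0, which also contains h = -oo; since s >= 0, the first lies in the second up to the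
    null event h >= 1. *)
Lemma probability_rescaled_support_bounds (disp : measure_display)
    (T : measurableType disp) (R : realType) (P : probability T R) (d : nat)
    (lambda : R) (X : T -> set 'rV[R]_d) (u : 'rV[R]_d) (x : \bar R) (t : R) :
  (0 < d)%N -> poisson_process P lambda X -> 0 < lambda -> enorm u = 1 ->
  let lk := lambda * kappa R d in
  let b := ln lk / d.+1%:R + (t - ln (regime_const x lk d) / 2) / d%:R in
  0 < regime_const x lk d -> 0 < b ->
  let Y w := rescaled_support x lk d (support_fun (poisson_polytope X w) u) in
  let p := expR (- (lk / wallis R d *
     cap_integral d.-1 (Num.sqrt (1 - expR (- (2 * b)))))) in
  P [set w | Y w <= t] \is a fin_num /\
  (p - expR (- (lk / 2)) <= fine (P [set w | Y w <= t]) <= p).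
Proof.
case: d X u => // d X u _ hX l0 u1 lk b m0 b0 Y p.
have mh := measurable_support_fun u hX.
pose h w := support_fun (poisson_polytope X w) u.
have mle r : measurable [set w | (h w <= r%:E)%E].
  by rewrite -[X in measurable X]setTI; exact: emeasurable_fun_infty_c.
have mY : measurable [set w | Y w <= t].
  rewrite -preimage_itvNyc -[X in measurable X]setTI.
  by apply: (measurableT_comp (@measurable_rescaled_support R x lk d.+1) mh).
have mge : measurable [set w | (1 <= h w)%E].
  by rewrite -[X in measurable X]setTI; exact: emeasurable_fun_c_infty.
have fY := fin_num_measure P _ mY; split => //.
pose s := Num.sqrt (1 - expR (- (2 * b))).
have s0 : 0 <= s by rewrite sqrtr_ge0.
have wk : lk / wallis R d.+1 = lambda * kappa R d.
  rewrite /lk kappaS; field; rewrite gt_eqF //; exact: wallis_gt0.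
have Ps : P [set w | (h w <= s%:E)%E] = p%:E.
  rewrite (probability_support_fun_le hX l0 u1); last by apply: le_trans s0; rewrite lerN10.
  by rewrite /p wk mulrA.
have P0 : P [set w | (h w <= 0%:E)%E] = (expR (- (lk / 2)))%:E.
  rewrite (probability_support_fun_le hX l0 u1) ?lerN10 // kappa_cap_integral0.
  by rewrite /lk mulrA.
have P1 := probability_support_fun_ge1 hX l0 u1.
have hY w : (0 <= h w)%E -> (h w < 1)%E -> (Y w <= t) = (h w <= s%:E)%E.
  rewrite /Y -/(h w); case: (h w) => [r|//|//]; rewrite !lee_fin lte_fin => r0 r1.
  by rewrite rescaled_support_le.
apply/andP; split; rewrite -lee_fin fineK //.
- rewrite EFinB leeBlDr // -Ps -P0.
  apply: (@le_trans _ _ (P ([set w | Y w <= t] `|` [set w | (h w <= 0%:E)%E]))).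
    apply: le_measure; rewrite ?inE //; first exact: measurableU.
    move=> w /= hs; have [h0|h0] := leP (h w) 0%E; first by right.
    left; have [h1|h1] := ltP (h w) 1%E; first by rewrite hY // ltW.
    exfalso; have := le_trans h1 hs; rewrite lee_fin leNgt => /negP; apply.
    by rewrite -sqrtr1 ltr_sqrt // ltrBlDr ltrDl expR_gt0.
  by apply: measureU2.
- rewrite -Ps -[leRHS]adde0 -P1.
  apply: (@le_trans _ _ (P ([set w | (h w <= s%:E)%E] `|` [set w | (1 <= h w)%E]))).
    apply: le_measure; rewrite ?inE //; first exact: measurableU.
    move=> w /= hs; have [h1|h1] := ltP (h w) 1%E; last by right.
    left; have [h0|h0] := leP 0%E (h w); first by rewrite -hY.
    by apply: (le_trans (ltW h0)); rewrite lee_fin.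
  by apply: measureU2.
Qed.

Theorem theorem2 (R : realType) (lambda : nat -> R)
  (disp : nat -> measure_display)
  (T : forall d : nat, measurableType (disp d))
  (P : forall d : nat, probability (T d) R)
  (X : forall d : nat, T d -> set 'rV[R]_d)
  (u : forall d : nat, 'rV[R]_d)
  (x : \bar R)
  (lambda_gt0 : forall d : nat, (2 <= d)%N -> 0 < lambda d)
  (X_poisson : forall d : nat, (2 <= d)%N ->
     poisson_process (P d) (lambda d) (@X d))
  (u_unit : forall d : nat, (2 <= d)%N -> unit_sphere (u d))
  (liminf_gt2 :
     (2%:E < limn_einf (fun d : nat => (lambda d * kappa R d / d%:R)%:E))%E)
  (x_ge0 : (0 <= x)%E)
  (x_lim : (fun d : nat => (1 / d%:R * ln (lambda d * kappa R d))%:E) @ \oo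
             --> x) :
  cvg_in_distribution P
    (fun d (w : T d) =>
       rescaled_support x (lambda d * kappa R d) d
         (support_fun (poisson_polytope (@X d) w) (u d)))
    (@gumbel_cdf R).
Proof.
split.
  near=> d; have d2 : (2 <= d)%N by near: d; exact: nbhs_infty_ge.
  apply: (measurableT_comp (@measurable_rescaled_support R x _ d)).
  exact: measurable_support_fun (X_poisson d d2).
move=> t _; pose L d := lambda d * kappa R d; pose m d := regime_const x (L d) d.
have hL : \forall d \near \oo, 2 * d%:R < L d.
  have h := near_limn_einf_gt liminf_gt2; near=> d.
  have d0 : 0 < d%:R :> R by rewrite ltr0n; near: d; exact: nbhs_infty_gt.
  by rewrite -ltr_pdivlMr //; near: d.
have L0 : \forall d \near \oo, 0 < L d.
  by near=> d; apply: (@le_lt_trans _ _ (2 * d%:R)); [rewrite mulr_ge0|near: d].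
have [moo lnm hq] : rate_conditions L m t.
  exact: rate_conditions_regime hL x_ge0 x_lim.
have [b0 hp] := cvg_cap_rate L0 moo lnm hq.
have m0 : \forall d \near \oo, 0 < m d by move/cvgryPgt : (moo); exact.
have key : \forall d \near \oo,
    let b := ln (L d) / d.+1%:R + (t - ln (m d) / 2) / d%:R in
    let p := expR (- (L d / wallis R d *
      cap_integral d.-1 (Num.sqrt (1 - expR (- (2 * b)))))) in
    let q := P d [set w | rescaled_support x (L d) d
         (support_fun (poisson_polytope (@X d) w) (u d)) <= t] in
    q \is a fin_num /\ p - expR (- (L d / 2)) <= fine q <= p.
  near=> d; have d2 : (2 <= d)%N by near: d; exact: nbhs_infty_ge.
  apply: probability_rescaled_support_bounds.
  - exact: ltnW.
  - exact: X_poisson.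
  - exact: lambda_gt0.
  - exact: u_unit.
  - by near: d.
  - by near: d.
apply/fine_cvgP; split; first by apply: filterS key => d [].
apply: (@squeeze_cvgr _ _ _ _
  (fun d => expR (- (L d / wallis R d * cap_integral d.-1 (Num.sqrt (1 - expR (- (2 *
     (ln (L d) / d.+1%:R + (t - ln (m d) / 2) / d%:R))))))) - expR (- (L d / 2)))
  (fun d => expR (- (L d / wallis R d * cap_integral d.-1 (Num.sqrt (1 - expR (- (2 *
     (ln (L d) / d.+1%:R + (t - ln (m d) / 2) / d%:R))))))))).
- by apply: filterS key => d [].
- rewrite -[X in _ --> X]subr0; apply: cvgB.
    apply: (@continuous_cvg _ _ _ _ _ _ expR); first exact: continuous_expR.
    exact: cvgN.
  (* The mass of h <= 0 is at most e^(-d), because L > 2 d. *)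
  apply: (@squeeze_cvgr _ _ _ _ (cst 0) (fun d : nat => expR (- d%:R))).
  + near=> d; have Ld : 2 * d%:R < L d by near: d.
    by rewrite /= expR_ge0 ler_expR lerN2 ler_pdivlMr // mulrC ltW.
  + exact: cvg_cst.
  + exact: cvgn_expR.
- apply: (@continuous_cvg _ _ _ _ _ _ expR); first exact: continuous_expR.
  exact: cvgN.
Unshelve. all: end_near. Qed.
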